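(* Let $r,s\ge1$ be integers, let $\widehat Q=\sum_{i=1}^sA_iw^{-i}$ be a $(\dot\varphi,r)$-Galois-closed irregular type with irregular class $\widehat\Theta$, let $g'\in W$ be an element generating its $(\dot\varphi,r)$-Galois-orbit, and set $\mathbf g=\dot\varphi g'\in GL(\mathfrak t)$. Let $$p_{\boldsymbol\phi}^{-1}(\dot\varphi,\mathbf g)=\bigcap_{i=1}^sp_{\phi_i}^{-1}\bigl(Z_{W,\phi_i}(\mathbf g)\bigr),\qquad Z_{W,\boldsymbol\phi}(\dot\varphi,\mathbf g)=p_{\boldsymbol\phi}^{-1}(\dot\varphi,\mathbf g)/W_{\mathfrak t_{\phi_1}}.$$ Then there is a Galois covering $$\mathbf B_{\dot\varphi,r}(\widehat Q)\longrightarrow\mathbf B_{\dot\varphi,r}(\widehat Q)/Z_{W,\boldsymbol\phi}(\dot\varphi,\mathbf g)\simeq\mathbf B_{\dot\varphi,r}(\widehat\Theta).$$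
   Context: $G$ is a connected complex reductive algebraic group with maximal torus $T$, Lie algebras $\mathfrak t\subset\mathfrak g$, root system $\Phi$, Weyl group $W$; $\mathfrak g'=[\mathfrak g,\mathfrak g]$, $\mathfrak t'=\mathfrak t\cap\mathfrak g'$, so that $\mathfrak t=\mathfrak Z(\mathfrak g)\oplus\mathfrak t'$, and $\Phi'$ is the root system of $(\mathfrak g',\mathfrak t')$, with the same Weyl group $W$. $\zeta_r=e^{2\pi\sqrt{-1}/r}$. Fix an outer automorphism $\dot\varphi=(f,\dot\varphi')\in\mathrm{Out}(\mathfrak g)\simeq GL(\mathfrak Z(\mathfrak g))\times\mathrm{Out}(\Phi')$, with $f$ of finite order, where $\mathrm{Out}(\Phi')=\mathrm{Aut}(\Phi')/W$ is identified with the subgroup of $\mathrm{Aut}(\Phi')$ preserving a chosen base of simple roots; $\dot\varphi$ is viewed as a linear automorphism of $\mathfrak t$. An irregular type is $\widehat Q=\sum_{i=1}^sA_iw^{-i}$, $A_i\in\mathfrak t$, identified with $(A_1,\dots,A_s)\in\mathfrak t^s$; its irregular class is its orbit for the diagonal $W$-action. An element $g'\in W$ generates its $(\dot\varphi,r)$-Galois-orbit if $\dot\varphi g'(A_i)=\zeta_r^iA_i$ for all $i$; $\widehat Q$ (and its class) is $(\dot\varphi,r)$-Galois-closed if such $g'$ exists. Let $d_\alpha(\widehat Q)$ be the pole order in $w$ of $\sum_i\alpha(A_i)w^{-i}$ ($0$ if this vanishes), $\alpha\in\Phi$. $\widehat Q\sim_{\dot\varphi,r}\widehat Q'$ means that some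 $g'\in W$ generates both $(\dot\varphi,r)$-Galois-orbits and $d_\alpha(\widehat Q)=d_\alpha(\widehat Q')$ for all $\alpha$; two $(\dot\varphi,r)$-Galois-closed classes are mutual $(\dot\varphi,r)$-admissible deformations if they are classes of irregular types $\widehat Q\sim_{\dot\varphi,r}\widehat Q'$. $\mathbf B_{\dot\varphi,r}(\widehat Q)\subset\mathfrak t^s$ and $\mathbf B_{\dot\varphi,r}(\widehat\Theta)\subset\mathfrak t^s/W$ are the spaces of $(\dot\varphi,r)$-admissible deformations (of irregularity at most $s$) of $\widehat Q$, resp. $\widehat\Theta$. $\phi_i=\{\alpha\in\Phi:\alpha(A_i)=\dots=\alpha(A_s)=0\}$; $\mathfrak t_\phi=\bigcap_{\alpha\in\phi}\ker\alpha$; $N_W(\mathfrak t_\phi)$, $W_{\mathfrak t_\phi}$ are the setwise/pointwise stabilizers in $W$; $W(\phi)=N_W(\mathfrak t_\phi)/W_{\mathfrak t_\phi}$ acts faithfully on $\mathfrak t_\phi$; $p_\phi:N_W(\mathfrak t_\phi)\to W(\phi)$ is the projection. $\mathbf g$ preserves $\mathfrak t_{\phi_i}$, with restriction $\mathbf g_{\phi_i}$, and $Z_{W,\phi_i}(\mathbf g)=\{x\in W(\phi_i):x\mathbf g_{\phi_i}=\mathbf g_{\phi_i}x\in GL(\mathfrak t_{\phi_i})\}$. *)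

(* Defs.v *)
From HB Require Import structures.
From mathcomp Require Import all_boot all_order all_algebra all_fingroup.
From mathcomp Require Import generic_quotient complex.
From mathcomp Require Import all_classical all_reals all_analysis.

Set Implicit Arguments.
Unset Strict Implicit.
Unset Printing Implicit Defensive.

Import Order.TTheory GRing.Theory Num.Theory.
Import numFieldNormedType.Exports.

Local Open Scope classical_set_scope.
Local Open Scope ring_scope.

Definition homeomorphism (X Y : topologicalType) (h : X -> Y) : Prop :=
  continuous h /\
  exists k : Y -> X, [/\ continuous k, cancel h k & cancel k h].

Definition maps_homeo_on (X Y : topologicalType) (p : X -> Y)
    (S : set X) (U : set Y) : Prop :=
  [/\ set_bij S U p, {within S, continuous p} &
      exists q : Y -> X,
        {within U, continuous q} /\ (forall x, S x -> q (p x) = x)].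

Definition evenly_covered (X Y : topologicalType) (p : X -> Y) (U : set Y) :=
  exists V : set (set X),
    [/\ forall S, V S -> open S, trivIset V id, \bigcup_(S in V) S = p @^-1` U
      & forall S, V S -> maps_homeo_on p S U].

Definition covering_map (X Y : topologicalType) (p : X -> Y) : Prop :=
  [/\ continuous p, set_surj setT setT p &
      forall y, exists U, [/\ open U, U y & evenly_covered p U]].

Definition deck (X Y : topologicalType) (p : X -> Y) : set (X -> X) :=
  [set h | homeomorphism h /\ forall x, p (h x) = p x].

Definition galois_covering (X Y : topologicalType) (p : X -> Y) : Prop :=
  [/\ connected [set: X], covering_map p &
      forall x x', p x = p x' -> exists2 h, deck p h & h x = x'].

(* Up to isomorphism, a connected complex reductive group G with a maximal
   torus T is the same thing as a reduced root datum.  X_*(T) and X^*(T) are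
   identified with Z^n, as columns and rows respectively, so that the pairing is
   the matrix product and t = Lie(T) = X_*(T) (x) C is the space of complex
   columns.  The roots are indexed by a finite type; rd_root a |-> rd_coroot a
   is the bijection between roots and coroots. *)
Record rootDatum (n : nat) := RootDatum {
  root_idx :> finType;
  rd_root : root_idx -> 'rV[int]_n;
  rd_coroot : root_idx -> 'cV[int]_n;
  root_inj : injective rd_root;
  coroot_inj : injective rd_coroot;
  pairing2 : forall a, (rd_root a *m rd_coroot a) 0 0 = 2;
  refl_root : forall a b,
    exists c, rd_root c =
      rd_root b - (rd_root b *m rd_coroot a) 0 0 *: rd_root a;
  refl_coroot : forall a b,
    exists c, rd_coroot c =
      rd_coroot b - (rd_root a *m rd_coroot b) 0 0 *: rd_coroot a;
  root_reduced : forall a b, rd_root b != 2 *: rd_root a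
}.

Definition is_base (n : nat) (D : rootDatum n) (Delta : {set D}) : Prop :=
  (forall c : D -> int, \sum_(a in Delta) c a *: rd_root a = 0 ->
     forall a, a \in Delta -> c a = 0) /\
  (forall b : D, exists c : D -> nat,
     rd_root b = \sum_(a in Delta) rd_root a *+ c a \/
     rd_root b = - \sum_(a in Delta) rd_root a *+ c a).

(* The complex numbers, sealed behind a structure so that the norm topology
   which the library puts on every numFieldType is found by inference. *)
Definition Cx (R : realType) : numClosedFieldType := R[i].

Definition zeta (R : realType) (r : nat) : Cx R :=
  (cos (2 * pi / r%:R) +i* sin (2 * pi / r%:R))%C.

Section Cartan.
Variables (R : realType) (n : nat) (D : rootDatum n).
Local Notation C := (Cx R).
Local Notation t := 'cV[C]_n.

Definition rootC (a : D) : 'rV[C]_n := map_mx intr (rd_root a).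
Definition corootC (a : D) : t := map_mx intr (rd_coroot a).

Definition reflC (a : D) : 'M[C]_n := 1%:M - corootC a *m rootC a.

(* Words in the reflections; no inverses are needed since these are
   involutions. *)
Definition weyl : set 'M[C]_n :=
  [set w | exists l : seq D, w = foldr (fun a => mulmx (reflC a)) 1%:M l].

Definition centre_t : set t := [set v | forall a : D, rootC a *m v = 0].
Definition derived_t : set t :=
  [set v | exists c : D -> C, v = \sum_(a : D) c a *: corootC a].

(* phi is the direct sum of f in GL(Z(g)), of finite order, and of an
   automorphism of the root system of (g', t') preserving the base Delta.
   As phi preserves Z(g) and t', it is harmless to compare the functionals
   alpha o phi and the roots on all of t. *)
Definition outer_aut (Delta : {set D}) (phi : 'M[C]_n) : Prop :=
  [/\ phi \in unitmx,
      (forall v, centre_t v -> centre_t (phi *m v)),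
      (forall v, derived_t v -> derived_t (phi *m v)),
      (exists2 m, (0 < m)%N &
         forall v, centre_t v -> iter m (mulmx phi) v = v)
    & exists2 sigma : {perm D},
        (forall a, rootC a *m phi = rootC (sigma a)) &
        [set sigma a | a in Delta]%SET = Delta].

Section Irregular.
Variable s : nat.

(* Q = A_1 w^-1 + ... + A_s w^-s is the matrix with columns A_1, ..., A_s:
   the ordinal i : 'I_s is the index of A_(i+1). *)
Local Notation irr_type := 'M[C]_(n, s).

Definition generates (phi : 'M[C]_n) (r : nat) (g' : 'M[C]_n)
    (Q : irr_type) : Prop :=
  weyl g' /\
  forall i : 'I_s, phi *m g' *m col i Q = zeta R r ^+ i.+1 *: col i Q.

Definition galois_closed (phi : 'M[C]_n) (r : nat) (Q : irr_type) : Prop :=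
  exists g', generates phi r g' Q.

Definition pole_order (a : D) (Q : irr_type) : nat :=
  \max_(i < s | rootC a *m col i Q != 0) i.+1.

Definition adm_equiv (phi : 'M[C]_n) (r : nat) (Q Q' : irr_type) : Prop :=
  (exists g', generates phi r g' Q /\ generates phi r g' Q') /\
  forall a : D, pole_order a Q = pole_order a Q'.

Definition weyl_equiv : rel irr_type :=
  fun Q Q' => `[< exists2 w, weyl w & Q' = w *m Q >].

Lemma weyl1 : weyl 1%:M. Proof. by exists [::]. Qed.

Lemma weylM w1 w2 : weyl w1 -> weyl w2 -> weyl (w1 *m w2).
Proof.
move=> [l1 ->] [l2 ->]; exists (l1 ++ l2)%SEQ.
by elim: l1 => [|a l IHl] /=; rewrite ?mul1mx // -mulmxA IHl.
Qed.

Lemma pairingC a : rootC a *m corootC a = 2%:M.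
Proof.
rewrite -map_mxM [_ *m _]mx11_scalar pairing2.
by apply/matrixP => i j; rewrite !mxE; case: eqP => //=; rewrite rmorph0.
Qed.

Lemma reflCK a : reflC a *m reflC a = 1%:M.
Proof.
rewrite /reflC mulmxBl mul1mx mulmxBr mulmx1 mulmxA -(mulmxA (corootC a)).
rewrite pairingC mul_mx_scalar -scalemxAl scaler_nat mulr2n.
by rewrite opprB addrK subrK.
Qed.

Lemma weylV w : weyl w ->
  exists w', [/\ weyl w', w' *m w = 1%:M & w *m w' = 1%:M].
Proof.
case=> l ->; elim: l => [|a l [w' [Ww' w'K Kw']]].
  by exists 1%:M; rewrite mulmx1; split=> //; exact: weyl1.
exists (w' *m reflC a); split=> /=.
- by apply: weylM => //; exists [:: a]; rewrite /= mulmx1.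
- by rewrite -mulmxA (mulmxA (reflC a)) reflCK mul1mx.
- by rewrite -mulmxA (mulmxA _ w') Kw' mul1mx reflCK.
Qed.

Lemma weyl_equiv_is_equiv : equiv_class_of weyl_equiv.
Proof.
split=> [Q|Q Q'|Q Q' Q''].
- by apply/asboolP; exists 1%:M; [exact: weyl1|rewrite mul1mx].
- apply/asboolP/asboolP => -[w Ww ->];
    have [w' [Ww' w'K _]] := weylV Ww;
    by exists w' => //; rewrite mulmxA w'K mul1mx.
- move=> /asboolP[w Ww ->] /asboolP[w' Ww' ->]; apply/asboolP.
  by exists (w' *m w); [exact: weylM|rewrite mulmxA].
Qed.

Canonical weyl_equiv_equiv := EquivRelPack weyl_equiv_is_equiv.

(* t^s / W, with the quotient topology. *)
Definition irr_class := quotient_topology {eq_quot weyl_equiv}%qT.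

Definition irr_class_of (Q : irr_type) : irr_class :=
  (\pi_(quotient_topology {eq_quot weyl_equiv}) Q)%qT.

Definition class_galois_closed (phi : 'M[C]_n) (r : nat) (Th : irr_class) :=
  exists Q, irr_class_of Q = Th /\ galois_closed phi r Q.

Definition mutual_adm_deformations (phi : 'M[C]_n) (r : nat)
    (Th Th' : irr_class) : Prop :=
  [/\ class_galois_closed phi r Th, class_galois_closed phi r Th' &
      exists Q Q', [/\ irr_class_of Q = Th, irr_class_of Q' = Th' &
                       adm_equiv phi r Q Q']].

Definition BQ (phi : 'M[C]_n) (r : nat) (Q : irr_type) : set irr_type :=
  [set Q' | adm_equiv phi r Q Q'].

Definition BTheta (phi : 'M[C]_n) (r : nat) (Th : irr_class) : set irr_class :=
  [set Th' | mutual_adm_deformations phi r Th Th'].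

(* phi_i for 1 <= i <= s. *)
Definition levi_roots (Q : irr_type) (i : nat) : {set D} :=
  [set a | [forall j : 'I_s, (i <= j.+1)%N ==> (rootC a *m col j Q == 0)]]%SET.

End Irregular.

Definition fixed_space (ph : {set D}) : set t :=
  [set v | forall a, a \in ph -> rootC a *m v = 0].

Definition setwise_stab (ph : {set D}) : set 'M[C]_n :=
  [set w | weyl w /\ [set w *m v | v in fixed_space ph] = fixed_space ph].
Definition pointwise_stab (ph : {set D}) : set 'M[C]_n :=
  [set w | weyl w /\ forall v, fixed_space ph v -> w *m v = v].

(* Elements of a quotient group N / K are left cosets w K, as sets of matrices;
   their product is the setwise one. *)
Definition left_coset (K : set 'M[C]_n) (w : 'M[C]_n) : set 'M[C]_n :=
  [set w *m u | u in K].
Definition quotient_by (N K : set 'M[C]_n) : set (set 'M[C]_n) :=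
  [set left_coset K w | w in N].
Definition left_coset_mul (X Y : set 'M[C]_n) : set 'M[C]_n :=
  [set w | exists x y, [/\ X x, Y y & w = x *m y]].

Definition subgroup (H : set 'M[C]_n) : Prop :=
  [/\ H 1%:M, (forall x y, H x -> H y -> H (x *m y)) &
      forall x, H x -> x \in unitmx /\ H (invmx x)].
Definition normal_subgroup (K H : set 'M[C]_n) : Prop :=
  [/\ subgroup K, subgroup H, K `<=` H &
      forall x u, H x -> K u -> K (x *m u *m invmx x)].

(* W(phi) *)
Definition Wrel (ph : {set D}) : set (set 'M[C]_n) :=
  quotient_by (setwise_stab ph) (pointwise_stab ph).
Definition proj (ph : {set D}) (w : 'M[C]_n) : set 'M[C]_n :=
  left_coset (pointwise_stab ph) w.

(* X in W(phi) acts on t_phi through any of its representatives w. *)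
Definition centralizer (ph : {set D}) (g : 'M[C]_n) : set (set 'M[C]_n) :=
  [set X | Wrel ph X /\ exists2 w, X w &
     forall v, fixed_space ph v -> w *m (g *m v) = g *m (w *m v)].

Lemma pointwise_stab1 ph : pointwise_stab ph 1%:M.
Proof. by split=> [|v _]; [exact: weyl1|rewrite mul1mx]. Qed.

Lemma pointwise_stabM ph u u' : pointwise_stab ph u -> pointwise_stab ph u' ->
  pointwise_stab ph (u *m u').
Proof.
move=> [Wu fu] [Wu' fu']; split=> [|v tv]; first exact: weylM.
by rewrite -mulmxA fu' // fu.
Qed.

Lemma pointwise_stabV ph u u' : pointwise_stab ph u -> weyl u' ->
  u' *m u = 1%:M -> pointwise_stab ph u'.
Proof.
by move=> [Wu fu] Wu' u'K; split=> // v tv; rewrite -{1}(fu v tv) mulmxA u'K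
  mul1mx.
Qed.

Lemma setwise_stab_in ph w v : setwise_stab ph w -> fixed_space ph v ->
  fixed_space ph (w *m v).
Proof. by move=> [_ e] tv; rewrite -e; exists v. Qed.

Lemma setwise_stab1 ph : setwise_stab ph 1%:M.
Proof.
split; first exact: weyl1.
by apply/seteqP; split=> [_ [v tv <-]|v tv]; [|exists v]; rewrite ?mul1mx.
Qed.

Lemma setwise_stabM ph w w' : setwise_stab ph w -> setwise_stab ph w' ->
  setwise_stab ph (w *m w').
Proof.
move=> Nw Nw'; have [[Ww e] [Ww' e']] := (Nw, Nw').
split; first exact: weylM.
apply/seteqP; split=> [_ [v tv <-]|v].
  by rewrite -mulmxA; do 2!apply: setwise_stab_in => //.
rewrite -{1}e => -[v1]; rewrite -{1}e' => -[v2 tv2 <- <-].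
by exists v2; rewrite ?mulmxA.
Qed.

Lemma setwise_stabV ph w w' : setwise_stab ph w -> weyl w' ->
  w' *m w = 1%:M -> w *m w' = 1%:M -> setwise_stab ph w'.
Proof.
move=> Nw Ww' w'K Kw'; have [Ww e] := Nw; split=> //.
apply/seteqP; split=> [_ [v tv <-]|v tv].
  by move: tv; rewrite -{1}e => -[u tu <-]; rewrite mulmxA w'K mul1mx.
exists (w *m v); first exact: setwise_stab_in.
by rewrite mulmxA w'K mul1mx.
Qed.

Lemma pointwise_stabJ ph w w' u : setwise_stab ph w -> weyl w' ->
  w' *m w = 1%:M -> w *m w' = 1%:M -> pointwise_stab ph u ->
  pointwise_stab ph (w' *m u *m w).
Proof.
move=> Nw Ww' w'K Kw' [Wu fu]; split.
  by apply: weylM; [exact: weylM|case: Nw].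
move=> v tv; rewrite -!mulmxA fu; last exact: setwise_stab_in.
by rewrite mulmxA w'K mul1mx.
Qed.

Section GaloisGroup.
Variables (s : nat) (Q : 'M[C]_(n, s)) (g : 'M[C]_n).

(* For s > 0, the conjunct weyl w is redundant. *)
Definition preimZ : set 'M[C]_n :=
  [set w | weyl w /\ forall i : 'I_s,
     let ph := levi_roots Q i.+1 in
     setwise_stab ph w /\ centralizer ph g (proj ph w)].

Definition Zgroup : set (set 'M[C]_n) :=
  quotient_by preimZ (pointwise_stab (levi_roots Q 1)).

Lemma preimZP w : preimZ w <-> weyl w /\ forall i : 'I_s,
  let ph := levi_roots Q i.+1 in setwise_stab ph w /\
  exists2 u, pointwise_stab ph u &
    forall v, fixed_space ph v -> w *m (u *m (g *m v)) = g *m (w *m v).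
Proof.
split=> -[Ww h]; split=> // i; have [Nw H] := h i; split=> //.
  case: H => _ [_ [u Ku <-] c]; exists u => // v tv.
  by rewrite mulmxA c // -mulmxA; case: Ku => _ ->.
split; first by exists w.
case: H => u Ku c; exists (w *m u); first by exists u.
by move=> v tv; rewrite -mulmxA c // -mulmxA; case: Ku => _ ->.
Qed.

Lemma preimZ1 : preimZ 1%:M.
Proof.
apply/preimZP; split=> [|i]; first exact: weyl1.
split; first exact: setwise_stab1.
by exists 1%:M => [|v tv]; [exact: pointwise_stab1|rewrite !mul1mx].
Qed.

Lemma preimZM w1 w2 : preimZ w1 -> preimZ w2 -> preimZ (w1 *m w2).
Proof.
move=> /preimZP[W1 h1] /preimZP[W2 h2]; apply/preimZP.
split=> [|i]; first exact: weylM.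
have [N1 [u1 K1 c1]] := h1 i; have [N2 [u2 K2 c2]] := h2 i.
split; first exact: setwise_stabM.
have [w' [Ww' w'K Kw']] := weylV W2.
exists (w' *m u1 *m w2 *m u2) => [|v tv].
  by apply: pointwise_stabM => //; exact: pointwise_stabJ.
have w2K (x : t) : w2 *m (w' *m x) = x by rewrite mulmxA Kw' mul1mx.
have tv2 := setwise_stab_in N2 tv.
by rewrite -!mulmxA w2K -(c1 _ tv2) -(c2 _ tv).
Qed.

Lemma preimZV w w' : preimZ w -> weyl w' -> w' *m w = 1%:M ->
  w *m w' = 1%:M -> preimZ w'.
Proof.
move=> /preimZP[W h] Ww' w'K Kw'; apply/preimZP; split=> // i.
have [N [u K c]] := h i.
have N' := setwise_stabV N Ww' w'K Kw'; split=> //.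
have [u' [Wu' u'K Ku']] := weylV (proj1 K).
exists (w *m u' *m w') => [|v tv].
  by apply: pointwise_stabJ => //; exact: pointwise_stabV K Wu' u'K.
have -> : g *m v = g *m (w *m (w' *m v)) by rewrite (mulmxA w) Kw' mul1mx.
rewrite -c; last exact: setwise_stab_in.
rewrite !mulmxA w'K mul1mx -(mulmxA u' w' w) w'K mulmx1 u'K mul1mx //.
Qed.

End GaloisGroup.

Section OrbitSpace.
Variables (s : nat) (phi : 'M[C]_n) (r : nat) (Q : 'M[C]_(n, s)).
Variable g' : 'M[C]_n.

(* Being in the same orbit of Zgroup on BQ: the action of Zgroup comes from
   that of preimZ, of which it is a quotient. *)
Definition Z_equiv : rel (BQ phi r Q) :=
  fun q q' => `[< exists2 w, preimZ Q (phi *m g') w &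
                    set_val q' = w *m set_val q >].

Lemma Z_equiv_is_equiv : equiv_class_of Z_equiv.
Proof.
split=> [q|q q'|q q' q''].
- by apply/asboolP; exists 1%:M; [exact: preimZ1|rewrite mul1mx].
- apply/asboolP/asboolP => -[w Pw ->];
    have [w' [Ww' w'K Kw']] := weylV (proj1 Pw);
    by exists w'; [exact: preimZV Pw _ _ _|rewrite mulmxA w'K mul1mx].
- move=> /asboolP[w Pw e] /asboolP[w' Pw' e']; apply/asboolP.
  by exists (w' *m w); [exact: preimZM|rewrite e' e mulmxA].
Qed.

Canonical Z_equiv_equiv := EquivRelPack Z_equiv_is_equiv.

Definition orbit_space := quotient_topology {eq_quot Z_equiv}%qT.

Definition orbit_map (q : BQ phi r Q) : orbit_space :=
  (\pi_(quotient_topology {eq_quot Z_equiv}) q)%qT.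

End OrbitSpace.
End Cartan.

(* Main.v *)
Require Import Defs.
From HB Require Import structures.
From mathcomp Require Import all_boot all_order all_algebra all_fingroup.
From mathcomp Require Import generic_quotient complex zify.
From mathcomp Require Import all_classical all_reals all_analysis.

(** By Steinberg's theorem an element of W fixing all the A_i fixes t_phi1
    pointwise, so that every point of B(Q) generates its Galois orbit through
    the same g' as Q.  Hence B(Q) is the complement of finitely many hyperplanes
    in the complex linear space of those Q' with g A'_i = zeta^i A'_i whose pole
    orders do not exceed those of Q, and it is connected.  By the same theorem
    the finite group Z acts freely on B(Q), which gives the Galois covering; the
    deck group is Z because a deck transformation agrees with a given element of
    Z on a clopen set.
    If q and w q lie in B(Q), then g^-1 w^-1 g w fixes q, hence t_phi1, so that w
    is in the preimage of Z: two points of B(Q) have the same irregular class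
    exactly when they are in the same orbit of Z.  The bijection between orbits
    and classes is closed since B(Q) is closed in W B(Q) and W is finite. *)

Set Implicit Arguments.
Unset Strict Implicit.
Unset Printing Implicit Defensive.

Import Order.TTheory GRing.Theory Num.Theory.
Import numFieldNormedType.Exports.

Local Open Scope classical_set_scope.
Local Open Scope ring_scope.

(** * Gram forms of roots and coroots *)

(** Two obstacles shape the algebra. The root datum carries no invariant form, and [outer_aut] tells
    how phi permutes the roots but is silent on individual coroots; yet the commutator of [g] and
    [w] lies in W only because phi carries reflections to reflections. The Gram form of the roots
    bridges the gap: every matrix that permutes the roots preserves it, it is nondegenerate on t',
    and it recovers each coroot from its root. Steinberg's theorem is classically an argument about
    a real point of a closed chamber, whereas here a tuple of complex vectors is fixed. An additive
    map from C^s to R that kills none of the nonzero rows alpha(Q) turns these rows into real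
    numbers, so that chambers, positivity and word length apply to all the A_i at once. For
    connectedness, a straight real segment between two points of B(Q) may cross the removed
    hyperplanes. The complex line through them meets these in finitely many points, which a suitably
    bent arc avoids. *)

Lemma eigen_span_ker (F : fieldType) (n : nat) (I : Type) (A : 'M[F]_n)
    (u : I -> 'rV[F]_n) (nu : I -> F) (s : seq I) (c : I -> F) :
  (forall i, u i *m A = nu i *: u i) -> (forall i, nu i != 0) ->
  (\sum_(i <- s) c i *: u i) *m A = 0 -> \sum_(i <- s) c i *: u i = 0.
Proof.
move=> uA nu0; elim: s c => [|j s IHs] c; first by rewrite big_nil.
set x := \sum_(i <- _ :: _) _ => xA0.
(* The difference loses its [j]-th term and only rescales the others, so induction applies to it; as
   [x *m A = 0], it equals [- nu j *: x]. *)
have eqx : x *m A - nu j *: x = \sum_(i <- s) (c i * (nu i - nu j)) *: u i.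
  rewrite /x !big_cons mulmxDl scalerDr -scalemxAl uA !scalerA mulrC opprD.
  rewrite addrACA subrr add0r mulmx_suml scaler_sumr -sumrB.
  apply: eq_bigr => i _; rewrite -scalemxAl uA !scalerA -scalerBl.
  by rewrite mulrBr (mulrC (nu j)).
have : \sum_(i <- s) (c i * (nu i - nu j)) *: u i = 0.
  by apply: IHs; rewrite -eqx mulmxBl -scalemxAl xA0 mul0mx scaler0 subrr.
rewrite -eqx xA0 sub0r => /eqP.
by rewrite oppr_eq0 scaler_eq0 (negbTE (nu0 j)) => /eqP.
Qed.

Lemma mulmx_cV_inj (F : pzRingType) (m n : nat) (A B : 'M[F]_(m, n)) :
  (forall v : 'cV_n, A *m v = B *m v) -> A = B.
Proof.
move=> e; apply/matrixP => i j; have := e (delta_mx j 0); rewrite -!colE.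
by move/matrixP/(_ i 0); rewrite !mxE.
Qed.

Section GramForm.
Variables (F : numFieldType) (n : nat) (I : finType) (u : I -> 'rV[F]_n).

(** For the roots this is the restriction to t of the Killing form, the sum of alpha(x) alpha(y). *)
Definition gram : 'M[F]_n := \sum_i (u i)^T *m u i.

Lemma tr_gram : gram^T = gram.
Proof.
by rewrite /gram raddf_sum; apply: eq_bigr => i _ /=; rewrite trmx_mul trmxK.
Qed.

Lemma gram_invariant (w : 'M[F]_n) (sigma : I -> I) : injective sigma ->
  (forall i, u i *m w = u (sigma i)) -> w^T *m gram *m w = gram.
Proof.
move=> si uw; rewrite /gram [RHS](reindex_inj si) /= mulmx_sumr mulmx_suml.
by apply: eq_bigr => i _; rewrite -uw trmx_mul !mulmxA.
Qed.

Lemma gram_quad (y : 'cV[F]_n) :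
  y^T *m gram *m y = (\sum_i (u i *m y) 0 0 ^+ 2)%:M.
Proof.
rewrite [RHS]raddf_sum /gram mulmx_sumr mulmx_suml; apply: eq_bigr => i _.
rewrite mulmxA -trmx_mul -mulmxA; move: (u i *m y) => z.
rewrite [z]mx11_scalar tr_scalar_mx mul_scalar_mx scale_scalar_mx mxE eqxx.
by rewrite mulr1n.
Qed.

(** The reflection preserves the form, negates [y] and fixes ker x, so [y] is orthogonal to ker x
    and the functional it represents is a multiple of [x]. Evaluation at [y] gives the factor: half
    the square length of [y]. *)
Lemma gram_refl (x : 'rV[F]_n) (y : 'cV[F]_n) (sigma : I -> I) :
  injective sigma -> x *m y = 2%:M ->
  (forall i, u i *m (1%:M - y *m x) = u (sigma i)) ->
  y^T *m gram = (\sum_i (u i *m y) 0 0 ^+ 2 / 2) *: x.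
Proof.
move=> si xy us; rewrite -mulr_suml; have /= := gram_invariant si us.
set s := 1%:M - _ => inv.
have sy : s *m y = - y.
  rewrite /s mulmxBl mul1mx -mulmxA xy mul_mx_scalar scaler_nat mulr2n.
  by rewrite opprD addrA subrr sub0r.
have e : y^T *m gram = - (y^T *m gram) + (y^T *m gram *m y) *m x.
  rewrite -{1}inv -mulmxA (mulmxA y^T) -trmx_mul sy linearN /= mulNmx mulmxA.
  by rewrite /s mulmxBr mulmx1 opprB addrC !mulmxA.
move: e; rewrite gram_quad mul_scalar_mx; set z := y^T *m gram => e.
have {}e : 2%:R *: z = (\sum_i (u i *m y) 0 0 ^+ 2) *: x.
  by rewrite scaler_nat mulr2n {2}e addNKr.
by rewrite mulrC -scalerA -e scalerA mulVf ?scale1r // pnatr_eq0.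
Qed.

End GramForm.

(** * Reflections, coroots and the finiteness of the Weyl group *)

Section Roots.
Variables (C : numClosedFieldType) (n : nat) (D : rootDatum n).
Local Notation t := 'cV[C]_n.

(* At C = Cx R these are, by conversion, rootC, corootC, reflC, weyl, centre_t
   and derived_t. *)
Definition rootF (a : D) : 'rV[C]_n := map_mx intr (rd_root a).
Definition corootF (a : D) : t := map_mx intr (rd_coroot a).
Definition reflF (a : D) : 'M[C]_n := 1%:M - corootF a *m rootF a.
Definition word (l : seq D) : 'M[C]_n :=
  foldr (fun a => mulmx (reflF a)) 1%:M l.
Definition weylF : set 'M[C]_n := [set w | exists l, w = word l].
Definition centreF : set t := [set v | forall a, rootF a *m v = 0].
Definition derivedF : set t :=
  [set v | exists c : D -> C, v = \sum_(a : D) c a *: corootF a].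
Definition pairing (a b : D) : int := (rd_root a *m rd_coroot b) 0 0.

Lemma pairingE a b : rootF a *m corootF b = (pairing a b)%:~R%:M.
Proof. by rewrite -map_mxM [_ *m _]mx11_scalar map_scalar_mx. Qed.

Lemma pairing_diag a : pairing a a = 2. Proof. exact: pairing2. Qed.

Lemma pairingF a : rootF a *m corootF a = 2%:M.
Proof. by rewrite pairingE pairing_diag. Qed.

Lemma reflFK a : reflF a *m reflF a = 1%:M.
Proof.
rewrite /reflF mulmxBl mul1mx mulmxBr mulmx1 mulmxA -(mulmxA (corootF a)).
rewrite pairingF mul_mx_scalar -scalemxAl scaler_nat mulr2n.
by rewrite opprB addrK subrK.
Qed.

Lemma word_cat l1 l2 : word (l1 ++ l2)%SEQ = word l1 *m word l2.
Proof. by elim: l1 => [|a l IHl] /=; rewrite ?mul1mx // -mulmxA IHl. Qed.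

Lemma weylF1 : weylF 1%:M. Proof. by exists [::]. Qed.

Lemma weylFM w1 w2 : weylF w1 -> weylF w2 -> weylF (w1 *m w2).
Proof. by move=> [l1 ->] [l2 ->]; exists (l1 ++ l2)%SEQ; rewrite word_cat. Qed.

Lemma weylF_word l : weylF (word l). Proof. by exists l. Qed.

Lemma weylF_refl a : weylF (reflF a).
Proof. by exists [:: a]; rewrite /= mulmx1. Qed.

Lemma weylF_ind (P : 'M[C]_n -> Prop) :
  P 1%:M -> (forall a w, weylF w -> P w -> P (reflF a *m w)) ->
  forall w, weylF w -> P w.
Proof.
move=> P1 PM w [l ->]; elim: l => //= a l IHl; apply: PM => //.
exact: weylF_word.
Qed.

Lemma weylF_unit w : weylF w -> w \in unitmx.
Proof.
move: w; apply: weylF_ind => [|a w _ uw]; first exact: unitmx1.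
by rewrite unitmx_mul uw andbT; case: (mulmx1_unit (reflFK a)).
Qed.

Lemma weylF_inv w : weylF w -> weylF (invmx w).
Proof.
move: w; apply: weylF_ind => [|a w Ww Wiw].
  by rewrite invmx1; exact: weylF1.
have uw := weylF_unit Ww; suff -> : invmx (reflF a *m w) = invmx w *m reflF a.
  by apply: weylFM => //; exact: weylF_refl.
have [ua _] := mulmx1_unit (reflFK a).
have uaw : reflF a *m w \in unitmx by rewrite unitmx_mul ua.
apply: (can_inj (mulKmx uaw)); rewrite mulmxV // -!mulmxA mulKVmx //.
by rewrite reflFK.
Qed.

Lemma rootF_inj : injective rootF.
Proof. 
move=> a b /matrixP e; apply: root_inj; apply/matrixP => i j.
by apply: (@intr_inj C); have := e i j; rewrite !mxE.
 Qed.

Lemma corootF_inj : injective corootF.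
Proof. 
move=> a b /matrixP e; apply: coroot_inj; apply/matrixP => i j.
by apply: (@intr_inj C); have := e i j; rewrite !mxE.
 Qed.

Lemma root_reflF a b :
  rootF b *m reflF a = rootF b - (pairing b a)%:~R *: rootF a.
Proof. by rewrite /reflF mulmxBr mulmx1 mulmxA pairingE mul_scalar_mx. Qed.

Lemma reflF_coroot a b :
  reflF a *m corootF b = corootF b - (pairing a b)%:~R *: corootF a.
Proof. by rewrite /reflF mulmxBl mul1mx -mulmxA pairingE mul_mx_scalar. Qed.

Lemma reflF_perm a : exists sigma : D -> D,
  injective sigma /\ forall b, rootF b *m reflF a = rootF (sigma b).
Proof.
have /choice[sigma sP] (b : D) : exists c, rootF b *m reflF a = rootF c.
  have [c ec] := refl_root a b; exists c.
  by rewrite root_reflF /rootF ec map_mxB map_mxZ.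
exists sigma; split=> // b c /(congr1 rootF); rewrite -!sP.
move/(congr1 (mulmx^~ (reflF a))).
by rewrite -!mulmxA reflFK !mulmx1 => /rootF_inj.
Qed.

Lemma reflF_coperm a : exists sigma : D -> D,
  injective sigma /\ forall b, reflF a *m corootF b = corootF (sigma b).
Proof.
have /choice[sigma sP] (b : D) : exists c, reflF a *m corootF b = corootF c.
  have [c ec] := refl_coroot a b; exists c.
  by rewrite reflF_coroot /corootF ec map_mxB map_mxZ.
exists sigma; split=> // b c /(congr1 corootF); rewrite -!sP.
move/(congr1 (mulmx (reflF a))).
by rewrite !mulmxA reflFK !mul1mx => /corootF_inj.
Qed.

Lemma weylF_perm w : weylF w -> exists sigma : D -> D,
  injective sigma /\ forall b, rootF b *m w = rootF (sigma b).
Proof.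
move: w; apply: weylF_ind => [|a w _ [tau [ti tP]]].
  by exists id; split=> // b; rewrite mulmx1.
have [sigma [si sP]] := reflF_perm a.
by exists (tau \o sigma); split=> [|b]; [exact: inj_comp|rewrite mulmxA sP tP].
Qed.

Local Notation N := (gram rootF).
Local Notation M := (gram (fun a => (corootF a)^T)).

(** Integrality of the pairings makes the squares nonnegative even in C, and the term of index [b]
    is 2. *)
Lemma sum_pairing_gt0 (f : D -> int) (b : D) : f b = 2 ->
  0 < \sum_i ((f i)%:~R : C) ^+ 2 / 2.
Proof.
move=> fb; rewrite (bigD1 b) //= ltr_pwDl //.
  by rewrite fb divr_gt0 ?exprn_gt0 ?ltr0Sn.
apply: sumr_ge0 => i _; rewrite divr_ge0 ?ler0n //.
by rewrite -[X in _ <= X]rmorphXn /= ler0z sqr_ge0.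
Qed.

Lemma coroot_gram b : exists2 l : C, 0 < l &
  (corootF b)^T *m N = l *: rootF b.
Proof.
have [sigma [si sP]] := reflF_perm b.
have -> := gram_refl si (pairingF b) sP.
eexists; last by [].
under eq_bigr => i _ do rewrite pairingE mxE eqxx mulr1n.
exact: (sum_pairing_gt0 (f := pairing^~ b) (pairing_diag b)).
Qed.

Lemma root_cogram b : exists2 l : C, 0 < l &
  rootF b *m M = l *: (corootF b)^T.
Proof.
have [sigma [si sP]] := reflF_coperm b.
have := @gram_refl C n D (fun a => (corootF a)^T) (corootF b)^T (rootF b)^T
   sigma si; rewrite trmxK => ->; first last.
- move=> a; rewrite -sP [RHS]trmx_mul /reflF [(_ - _)^T]linearB /=.
  by rewrite [in RHS]trmx_mul trmx1.
- by rewrite -trmx_mul pairingF tr_scalar_mx.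
eexists; last by [].
under eq_bigr => i _ do rewrite -trmx_mul pairingE tr_scalar_mx mxE eqxx mulr1n.
exact: (sum_pairing_gt0 (f := pairing b) (pairing_diag b)).
Qed.

(** Each Gram form exchanges a root and its coroot up to a positive factor, so every coroot is an
    eigenvector of [N *m M] with nonzero eigenvalue, and this product is injective on their span. *)
Lemma derived_gram_eq0 (x : t) : derivedF x -> x^T *m N = 0 -> x = 0.
Proof.
move=> [c ex] xN; apply: trmx_inj; rewrite trmx0.
have ext : x^T = \sum_a c a *: (corootF a)^T.
  by rewrite ex [LHS]raddf_sum; apply: eq_bigr => a _; rewrite [LHS]linearZ.
have /choice[nu nuP] (a : D) : exists l : C, l != 0 /\
    (corootF a)^T *m (N *m M) = l *: (corootF a)^T.
  have [l l0 el] := root_cogram a; have [k k0 ek] := coroot_gram a.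
  exists (k * l); rewrite mulf_neq0 ?gt_eqF //; split => //.
  by rewrite mulmxA ek -scalemxAl el scalerA.
rewrite ext; apply: (@eigen_span_ker C n D (N *m M) _ nu).
- by move=> a; case: (nuP a).
- by move=> a; case: (nuP a).
- by rewrite -ext mulmxA xN mul0mx.
Qed.

Lemma derived_centre_eq0 (x : t) : derivedF x -> centreF x -> x = 0.
Proof.
move=> dx cx; apply: derived_gram_eq0 => //; apply: trmx_inj.
rewrite trmx0 trmx_mul trmxK tr_gram /gram mulmx_suml big1 // => a _.
by rewrite -mulmxA cx mulmx0.
Qed.

Lemma derived_coroot a : derivedF (corootF a).
Proof.
exists (fun b => (b == a)%:R).
rewrite (bigD1 a) //= eqxx scale1r big1 ?addr0 //.
by move=> b /negbTE->; rewrite scale0r.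
Qed.

Lemma derived_add x y : derivedF x -> derivedF y -> derivedF (x + y).
Proof.
move=> [c ->] [d ->]; exists (fun a => c a + d a).
by rewrite -big_split /=; apply: eq_bigr => a _; rewrite scalerDl.
Qed.

Lemma derived_scale k x : derivedF x -> derivedF (k *: x).
Proof.
move=> [c ->]; exists (fun a => k * c a).
by rewrite scaler_sumr; apply: eq_bigr => a _; rewrite scalerA.
Qed.

Lemma derived_opp x : derivedF x -> derivedF (- x).
Proof. by rewrite -scaleN1r; exact: derived_scale. Qed.

(* The coroot attached to a root is intrinsic: it is the vector of t' of the
   right length which represents the root for the Gram form of the roots. *)
Lemma coroot_unique a (x : t) (l : C) : derivedF x ->
  rootF a *m x = 2%:M -> x^T *m N = l *: rootF a -> x = corootF a.
Proof.
move=> dx ax xN; have [k k0 ek] := coroot_gram a.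
have : (x^T *m N *m corootF a)^T = (corootF a)^T *m N *m x.
  by rewrite !trmx_mul trmxK tr_gram mulmxA.
rewrite xN ek -![in LHS]scalemxAl -![in RHS]scalemxAl ax pairingF.
rewrite linearZ /= tr_scalar_mx => /eqP; rewrite -subr_eq0 -scalerBl.
rewrite scaler_eq0 subr_eq0.
case/orP => [/eqP elk|/eqP/matrixP/(_ 0 0)/eqP]; last first.
  by rewrite !mxE eqxx mulr1n pnatr_eq0.
apply/eqP; rewrite -subr_eq0; apply/eqP; apply: derived_gram_eq0.
  by apply: derived_add => //; apply: derived_opp; exact: derived_coroot.
by rewrite linearB /= mulmxBl xN ek elk subrr.
Qed.

(** Knowledge about roots passes to coroots: [w] preserves the Gram form of the roots, so the image
    satisfies the three conditions that characterize the coroot in [coroot_unique]. *)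
Lemma coroot_transport (w : 'M[C]_n) (sigma : D -> D) :
  w \in unitmx -> (forall v, derivedF v -> derivedF (w *m v)) ->
  (forall b, rootF b *m w = rootF (sigma b)) ->
  forall a, w *m corootF (sigma a) = corootF a.
Proof.
move=> uw dw rw a.
have si : injective sigma.
  move=> b c /(congr1 rootF); rewrite -!rw.
  by move/(congr1 (mulmx^~ (invmx w))); rewrite !mulmxK // => /rootF_inj.
have [l _ el] := coroot_gram (sigma a).
apply: (@coroot_unique _ _ l).
- by apply: dw; exact: derived_coroot.
- by rewrite mulmxA rw pairingF.
- apply: (can_inj (mulmxK uw)); rewrite -scalemxAl rw trmx_mul -!mulmxA.
  by rewrite (mulmxA w^T) (gram_invariant si rw).
Qed.

Lemma reflF_transport (w : 'M[C]_n) (sigma : D -> D) :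
  w \in unitmx -> (forall v, derivedF v -> derivedF (w *m v)) ->
  (forall b, rootF b *m w = rootF (sigma b)) ->
  forall a, reflF a *m w = w *m reflF (sigma a).
Proof.
move=> uw dw rw a; rewrite /reflF mulmxBl mulmxBr mul1mx mulmx1.
by rewrite -mulmxA rw (mulmxA w) (coroot_transport uw dw rw).
Qed.

Lemma weylF_sub_derived w v : weylF w -> derivedF (w *m v - v).
Proof.
move=> Ww; move: w Ww v; apply: weylF_ind => [v|a w _ IHw v].
  rewrite mul1mx subrr; exists (fun=> 0).
  by rewrite big1 // => a _; rewrite scale0r.
rewrite -[_ - v](subrKA (w *m v)); apply: derived_add => //.
rewrite -mulmxA {1}/reflF mulmxBl mul1mx addrAC subrr sub0r.
apply: derived_opp; rewrite -mulmxA [rootF a *m _]mx11_scalar mul_mx_scalar.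
by apply: derived_scale; exact: derived_coroot.
Qed.

Lemma weylF_derived w v : weylF w -> derivedF v -> derivedF (w *m v).
Proof.
move=> Ww dv; rewrite -(subrK v (w *m v)); apply: derived_add => //.
exact: weylF_sub_derived.
Qed.

(** The Weyl group moves vectors by combinations of coroots, so [invmx w' *m w - 1%:M] has its image
    in t'; all roots vanish on this image, which is therefore central as well, hence zero. Thus W
    embeds into the permutations of the roots. *)
Lemma weylF_eq w w' : weylF w -> weylF w' ->
  (forall a, rootF a *m w = rootF a *m w') -> w = w'.
Proof.
move=> Ww Ww' e.
suff e0 : invmx w' *m w - 1%:M = 0.
  by rewrite -(mulKVmx (weylF_unit Ww') w) (subr0_eq e0) mulmx1.
apply: mulmx_cV_inj => v; rewrite mul0mx mulmxBl mul1mx.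
apply: derived_centre_eq0.
  by apply: weylF_sub_derived; apply: weylFM => //; exact: weylF_inv.
move=> a; rewrite mulmxBr !mulmxA.
suff -> : rootF a *m invmx w' *m w = rootF a by rewrite subrr.
have [sigma [_ sP]] := weylF_perm (weylF_inv Ww').
by rewrite sP e -sP mulmxKV ?weylF_unit.
Qed.

Lemma finite_weylF : finite_set weylF.
Proof.
have /choice[pick pickP] (f : {ffun D -> D}) : exists w : 'M[C]_n, forall w',
    weylF w' -> (forall b, rootF b *m w' = rootF (f b)) -> w' = w.
  have [[w [Ww wf]]|nw] := pselect (exists w, weylF w /\
      forall b, rootF b *m w = rootF (f b)).
    by exists w => w' Ww' wf'; apply: weylF_eq => // a; rewrite wf wf'.
  by exists 0 => w' Ww' wf'; exfalso; apply: nw; exists w'.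
apply: (@sub_finite_set _ _ (range pick)).
  move=> w Ww; have [sigma [_ sP]] := weylF_perm Ww.
  exists (finfun sigma) => //; apply/esym/pickP => // b.
  by rewrite sP ffunE.
by apply: finite_image; exact: finite_finset.
Qed.

End Roots.

(** * Steinberg's fixed-point theorem *)

Lemma exists_common_nonroot (R : numDomainType) (I : finType)
    (p : I -> {poly R}) :
  exists x : R, forall i, p i != 0 -> (p i).[x] != 0.
Proof.
pose P := \prod_(i | p i != 0) p i.
have P0 : P != 0 by apply/prodf_neq0.
pose rs := [seq k%:R : R | k <- iota 0 (size P)].
have [|/allPn[x _ xP]] := boolP (all (root P) rs).
  move/(max_poly_roots P0); rewrite map_inj_uniq ?iota_uniq; last first.
    by move=> m k /eqP; rewrite eqr_nat => /eqP.
  by move=> /(_ isT); rewrite size_map size_iota ltnn.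
exists x => i pi0; apply: contra xP; rewrite /root /P (bigD1 i) //= hornerM.
by move/eqP=> ->; rewrite mul0r.
Qed.

(** The real and imaginary parts of a row are taken as the coefficients of a real polynomial, which
    is evaluated at a point that is a root of none of the finitely many nonzero ones. Additivity is
    what integral combinations of simple roots call for. *)
Lemma exists_generic_additive (R : realType) (s : nat) (I : finType)
    (y : I -> 'rV[Cx R]_s) :
  exists L : {additive 'rV[Cx R]_s -> R}, forall i, L (y i) = 0 -> y i = 0.
Proof.
pose u (z : 'rV[Cx R]_s) : 'rV[R]_(s + s) :=
  row_mx (map_mx (@complex.Re R) z) (map_mx (@complex.Im R) z).
have [x xP] := exists_common_nonroot (fun i => rVpoly (u (y i))).
pose L z := (rVpoly (u z)).[x].
have LB : {morph L : a b / a - b}.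
  move=> a b; rewrite /L -hornerN -hornerD -linearB; congr (rVpoly _).[x].
  rewrite /u opp_row_mx add_row_mx; congr row_mx; apply/matrixP=> i j;
  by rewrite !mxE raddfB.
pose La : {additive 'rV[Cx R]_s -> R} :=
  HB.pack L (GRing.isZmodMorphism.Build _ _ L LB).
exists La => i /eqP; rewrite /= => Ly0.
apply/eqP; apply: contraLR Ly0 => y0; apply: xP; apply: contra y0 => /eqP r0.
have : u (y i) = 0.
  by rewrite -[LHS]rVpolyK r0 linear0.
rewrite /u -[RHS]hsubmxK !linear0 => /eq_row_mx[/matrixP e1 /matrixP e2].
apply/eqP/matrixP => k j; have := e1 k j; have := e2 k j; rewrite !mxE.
by case: (y i k j) => a b /= -> ->.
Qed.

(** * Positive roots and words in simple reflections *)

Section Base.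
Variables (R : realDomainType) (C : numClosedFieldType) (n : nat).
Variable D : rootDatum n.
Local Notation t := 'cV[C]_n.
Local Notation rootF := (@rootF C n D).
Local Notation corootF := (@corootF C n D).
Local Notation reflF := (@reflF C n D).
Local Notation weylF := (@weylF C n D).
Local Notation word := (@word C n D).

(** Both pairings are positive multiples of the value of the Gram form on the two coroots. *)
Lemma pairing_sym_gt0 (a b : D) : 0 < pairing a b -> 0 < pairing b a.
Proof.
have [k k0 ek] := coroot_gram C a; have [l l0 el] := coroot_gram C b => ab.
have : ((corootF a)^T *m gram rootF *m corootF b)^T =
       (corootF b)^T *m gram rootF *m corootF a.
  by rewrite !trmx_mul trmxK tr_gram mulmxA.
rewrite ek el -[in LHS]scalemxAl -[in RHS]scalemxAl !pairingE.
rewrite !scale_scalar_mx tr_scalar_mx => /matrixP/(_ 0 0).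
rewrite !mxE eqxx !mulr1n => e.
by rewrite -(@ltr0z C) -(pmulr_rgt0 _ l0) -e pmulr_rgt0 ?ltr0z.
Qed.

Lemma exists_sref : exists sref : D -> D -> D, forall a b,
  rd_root (sref a b) = rd_root b - pairing b a *: rd_root a.
Proof.
suff /choice[f fP] (a : D) : exists f : D -> D, forall b,
  rd_root (f b) = rd_root b - pairing b a *: rd_root a by exists f.
by have /choice[f fP] := refl_root a; exists f.
Qed.

Variables (Delta : {set D}) (cf : D -> D -> int) (sref : D -> D -> D).
Hypothesis Delta_free : forall c : D -> int,
  \sum_(a in Delta) c a *: rd_root a = 0 -> forall a, a \in Delta -> c a = 0.
Hypothesis cfE : forall b, rd_root b = \sum_(a in Delta) cf b a *: rd_root a.
Hypothesis cf_sign : forall b,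
  (forall a, a \in Delta -> 0 <= cf b a) \/
  (forall a, a \in Delta -> cf b a <= 0).
Hypothesis srefE : forall a b,
  rd_root (sref a b) = rd_root b - pairing b a *: rd_root a.

Definition positive b := [forall a in Delta, 0 <= cf b a].

Lemma cf_unique b (c : D -> int) :
  rd_root b = \sum_(a in Delta) c a *: rd_root a ->
  forall a, a \in Delta -> cf b a = c a.
Proof.
move=> e a aD; apply/eqP; rewrite -subr_eq0; apply/eqP.
apply: (Delta_free (c := fun a => cf b a - c a)) => //.
by under eq_bigr => i _ do rewrite scalerBl; rewrite sumrB -e -cfE subrr.
Qed.

Lemma negativeP b : ~~ positive b -> forall a, a \in Delta -> cf b a <= 0.
Proof. by case: (cf_sign b) => // bp /forall_inP. Qed.

Lemma cf_sref a b : a \in Delta ->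
  forall c, c \in Delta -> cf (sref a b) c = cf b c - pairing b a * (c == a)%:R.
Proof.
move=> aD; apply: cf_unique; rewrite srefE {1}cfE.
under [RHS]eq_bigr => c _ do rewrite scalerBl -scalerA.
rewrite sumrB -scaler_sumr; congr (_ - _ *: _).
rewrite (bigD1 a) //= eqxx scale1r big1 ?addr0 // => c /andP[_ /negbTE->].
by rewrite scale0r.
Qed.

Lemma sref_self a : rd_root (sref a a) = - rd_root a.
Proof.
by rewrite srefE pairing_diag scaler_nat mulr2n opprD addrA subrr sub0r.
Qed.

Lemma cf_sref_self a c : c \in Delta -> cf (sref a a) c = - cf a c.
Proof.
move=> cD; apply: (cf_unique (c := fun c => - cf a c)) => //.
rewrite sref_self {1}cfE -sumrN.
by apply: eq_bigr => i _; rewrite scaleNr.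
Qed.

Lemma root_neq0 (b : D) : rd_root b != 0.
Proof.
apply: contra_eq_neq (pairing2 b) => ->; rewrite mul0mx mxE; exact: eqP.
Qed.

Lemma positive_neq0 b : positive b -> exists2 a, a \in Delta & 0 < cf b a.
Proof.
move=> /forall_inP bp; apply/exists_inP; apply: contraT => /exists_inPn h.
have := root_neq0 b; rewrite cfE big1 ?eqxx // => a aD.
have := h a aD; rewrite lt_neqAle bp // andbT negbK => /eqP <-.
by rewrite scale0r.
Qed.

Lemma positive_sref_self b : positive (sref b b) = ~~ positive b.
Proof.
apply/idP/idP => [bp|bn].
  have [a aD] := positive_neq0 bp; rewrite cf_sref_self // oppr_gt0 => ba.
  by apply/negP => /forall_inP/(_ a aD); rewrite leNgt ba.
apply/forall_inP => a aD; rewrite cf_sref_self // oppr_ge0.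
exact: negativeP.
Qed.

Lemma cf_simple a c : a \in Delta -> c \in Delta -> cf a c = (c == a)%:R.
Proof.
move=> aD; apply: (cf_unique (c := fun c => (c == a)%:R)).
rewrite (bigD1 a) //= eqxx scale1r big1 ?addr0 // => b /andP[_ /negbTE->].
by rewrite scale0r.
Qed.

Lemma positive_simple a : a \in Delta -> positive a.
Proof. by move=> aD; apply/forall_inP => c cD; rewrite cf_simple. Qed.

(** A positive coefficient at another simple root is unchanged and decides the sign. Without one,
    [b] is a multiple of [a], and [pairing b b = 2] forces the factor 1 or 2; the first gives
    [b = a], the second contradicts reducedness. *)
Lemma positive_sref a b : a \in Delta -> positive b -> b != a ->
  positive (sref a b).
Proof.
move=> aD bp ba.
have [/exists_inP[c cD /andP[ca bc]]|/exists_inPn h] :=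
  boolP [exists c in Delta, (c != a) && (0 < cf b c)].
  apply: contraT => /negativeP/(_ c cD).
  by rewrite cf_sref // (negbTE ca) mulr0 subr0 leNgt bc.
have bE : rd_root b = cf b a *: rd_root a.
  rewrite {1}cfE (bigD1 a) //= big1 ?addr0 // => c /andP[cD ca].
  have := h c cD; rewrite ca /= lt_neqAle (forall_inP bp) // andbT negbK.
  by move=> /eqP <-; rewrite scale0r.
have := pairing_diag b; rewrite /pairing bE -scalemxAl mxE -/(pairing a b).
have b0 := forall_inP bp a aD => e.
have [k1|k2] : cf b a = 1 \/ cf b a = 2.
  move: (cf b a) (pairing a b) b0 e => [k|//] m _ /(congr1 absz).
  rewrite abszM /= => e; have : (k %| 2)%N by rewrite -[2%N]e dvdn_mulr.
  move=> k2; have := @dvdn_leq k 2 isT k2; move: k2.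
  by case: k {e} => [|[|[|k]]] // _ _; [left|right].
  by move: bE ba; rewrite k1 scale1r => /root_inj ->; rewrite eqxx.
by have := root_reduced a b; rewrite bE k2 eqxx.
Qed.

Lemma rootF_sref a b : rootF b *m reflF a = rootF (sref a b).
Proof. by rewrite root_reflF /rootF srefE map_mxB map_mxZ. Qed.

Lemma srefK a : involutive (sref a).
Proof.
by move=> b; apply: (@rootF_inj C); rewrite -!rootF_sref -mulmxA reflFK mulmx1.
Qed.

Lemma reflF_sref a b : reflF b *m reflF a = reflF a *m reflF (sref a b).
Proof.
apply: (reflF_transport (sigma := sref a)).
- exact: weylF_unit (weylF_refl _ _).
- by move=> v; exact: weylF_derived (weylF_refl _ _).
- exact: rootF_sref.
Qed.

Lemma reflF_sref_self b : reflF (sref b b) = reflF b.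
Proof.
by rewrite -[LHS]mul1mx -(reflFK C b) -mulmxA -reflF_sref reflFK mulmx1.
Qed.

(** Expanding the left argument of [pairing b b = 2] over the base, some term is positive; the sign
    of a pairing is symmetric. *)
Lemma exists_simple_descent b : positive b ->
  exists a, [/\ a \in Delta, 0 < cf b a & 0 < pairing b a].
Proof.
move=> bp; apply: contrapT => h.
suff : pairing b b <= 0 by rewrite pairing_diag.
rewrite /pairing {1}cfE mulmx_suml summxE; apply: sumr_le0 => a aD.
rewrite -scalemxAl mxE -/(pairing a b).
have := forall_inP bp a aD; rewrite le_eqVlt => /orP[/eqP<-|ba].
  by rewrite mul0r.
rewrite pmulr_rle0 // leNgt; apply/negP => /pairing_sym_gt0 ab.
by apply: h; exists a.
Qed.

(** Induction on the height, the sum of the coefficients: a simple [a] with [0 < pairing b a] lowers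
    it, and the reflection in [b] is the conjugate by [reflF a] of the one in [sref a b]. *)
Lemma positive_reflF_word b : positive b ->
  exists2 l, {subset l <= Delta} & reflF b = word l.
Proof.
have [k] := ubnP `|(\sum_(a in Delta) cf b a)%R|%N.
elim: k b => // k IHk b hk bp.
have [a [aD ba pba]] := exists_simple_descent bp.
have [eba|nba] := eqVneq b a.
  by exists [:: a]; rewrite ?eba /= ?mulmx1 // => c; rewrite inE => /eqP ->.
have cp := positive_sref aD bp nba.
have hc : \sum_(c in Delta) cf (sref a b) c
    = \sum_(c in Delta) cf b c - pairing b a.
  under eq_bigr => c cD do rewrite cf_sref //.
  rewrite sumrB -mulr_sumr; congr (_ - _).
  rewrite (bigD1 a) //= eqxx big1 ?addr0 ?mulr1 // => c /andP[_ /negbTE->].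
  by [].
have s0 d : positive d -> 0 <= \sum_(c in Delta) cf d c.
  by move=> /forall_inP dp; apply: sumr_ge0.
have [] := IHk (sref a b) _ cp.
  have := s0 _ bp; have := s0 _ cp; rewrite hc; move: hk pba.
  by move: (\sum_(_ in _) _) (pairing _ _); lia.
move=> l lD el; exists (a :: l ++ [:: a])%SEQ.
  move=> c; rewrite inE mem_cat mem_seq1 => /or3P[/eqP->|/lD|/eqP->] //.
have -> : word (a :: l ++ [:: a])%SEQ = reflF a *m (word l *m reflF a).
  by rewrite /= word_cat /= mulmx1.
by rewrite -el mulmxA -(reflF_sref a b) -mulmxA (reflFK C a) mulmx1.
Qed.

Lemma reflF_word b : exists2 l, {subset l <= Delta} & reflF b = word l.
Proof.
have [/positive_reflF_word//|] := boolP (positive b).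
by rewrite -positive_sref_self -reflF_sref_self; exact: positive_reflF_word.
Qed.

Lemma weyl_simple_word w : weylF w ->
  exists2 l, {subset l <= Delta} & w = word l.
Proof.
move: w; apply: weylF_ind => [|a w _ [l lD ->]]; first by exists [::].
have [l' lD' ->] := reflF_word a; exists (l' ++ l)%SEQ;
  last by rewrite word_cat.
by move=> c; rewrite mem_cat => /orP[/lD'|/lD].
Qed.

(** This is the deletion condition. A simple reflection makes no positive root negative except its
    own, so a root that changes sign along the word must meet its own letter; [reflF a], pushed
    through the word up to there, cancels that letter. *)
Lemma word_deletion l a c : {subset l <= Delta} -> positive a ->
  rootF a *m word l = rootF c -> ~~ positive c ->
  exists l', [/\ {subset l' <= Delta}, (size l' < size l)%N &
    reflF a *m word l = word l'].
Proof.
elim: l a => [|b l IHl] a lD ap /=.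
  by rewrite mulmx1 => /rootF_inj <-; rewrite ap.
have bD : b \in Delta by apply: lD; rewrite mem_head.
have lD' : {subset l <= Delta} by move=> d dl; apply: lD; rewrite inE dl orbT.
have [->|nab] := eqVneq a b.
  by move=> _ _; exists l; rewrite mulmxA reflFK mul1mx.
rewrite mulmxA rootF_sref => ec cn.
have [l' [l'D sl' el']] := IHl _ lD' (positive_sref bD ap nab) ec cn.
exists (b :: l'); split => //=.
  by move=> d; rewrite inE => /orP[/eqP->|/l'D].
by rewrite -el' mulmxA (reflF_sref b a) -mulmxA.
Qed.

(** * Dominant irregular types and their stabilizers *)

Section Dominant.
Variables (s : nat) (L : {additive 'rV[C]_s -> R}).

Definition dominant (Q : 'M[C]_(n, s)) :=
  forall a, a \in Delta -> 0 <= L (rootF a *m Q).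

Lemma additive_root Q b :
  L (rootF b *m Q) = \sum_(a in Delta) L (rootF a *m Q) *~ cf b a.
Proof.
have -> : rootF b = \sum_(a in Delta) (cf b a)%:~R *: rootF a.
  rewrite /rootF {1}cfE map_mx_sum.
  by apply: eq_bigr => a _; rewrite map_mxZ /rootF.
rewrite mulmx_suml raddf_sum; apply: eq_bigr => a _.
by rewrite -scalemxAl scaler_int raddfMz.
Qed.

Lemma dominant_ge0 Q b : dominant Q -> positive b -> 0 <= L (rootF b *m Q).
Proof.
move=> dQ /forall_inP bp; rewrite additive_root; apply: sumr_ge0 => a aD.
by rewrite mulrz_ge0 // ?dQ ?bp.
Qed.

(** Reflecting in a simple root of negative value permutes the other positive roots and corrects
    that one, so the number of positive roots with negative value drops. *)
Lemma exists_dominant Q : exists2 w, weylF w & dominant (w *m Q).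
Proof.
have [k] := ubnP #|[set b | positive b & (L (rootF b *m Q) < 0)%R]%SET|.
elim: k Q => // k IHk Q hk.
have [dQ|] := pselect (dominant Q).
  by exists 1%:M; [exact: weylF1|rewrite mul1mx].
move=> /existsNP[a /not_implyP[aD /negP]]; rewrite -ltNge => aQ.
suff /IHk[w Ww dw] : (#|[set b | positive b &
    (L (rootF b *m (reflF a *m Q)) < 0)%R]%SET| < k)%N.
  exists (w *m reflF a); last by rewrite -mulmxA.
  by apply: weylFM => //; exact: weylF_refl.
rewrite -(card_imset _ (inv_inj (srefK a))).
have aN : a \in [set b | positive b & (L (rootF b *m Q) < 0)%R]%SET.
  by rewrite inE positive_simple.
move: hk; rewrite (cardsD1 a) aN add1n ltnS; apply: leq_ltn_trans.
apply/subset_leq_card/fintype.subsetP => _ /imsetP[b + ->].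
rewrite !inE mulmxA rootF_sref => /andP[bp bQ]; rewrite bQ andbT.
have nb : b != a.
  apply: contraTneq bQ => ->.
  have -> : rootF (sref a a) = - rootF a.
    by rewrite /rootF sref_self map_mxN.
  by rewrite mulNmx raddfN oppr_lt0 -leNgt ltW.
rewrite positive_sref // andbT.
apply: contraTneq bp => e; rewrite -(srefK a b) e positive_sref_self.
by rewrite positive_simple.
Qed.

(** Induction on the length of a word with first letter [a] and rest [l]. If [word l] turns [a] into
    a negative root, deletion shortens the word. Otherwise the fixed-point equation makes alpha(Q)
    the opposite of the value of a positive root, so dominance forces [L] to vanish on it and
    genericity gives alpha(Q) = 0. Then [reflF a] fixes both [Q] and [v], and [l] remains. *)
Lemma word_stabilizer Q (v : t) l : {subset l <= Delta} -> dominant Q ->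
  (forall a, L (rootF a *m Q) = 0 -> rootF a *m Q = 0) ->
  (forall a, rootF a *m Q = 0 -> rootF a *m v = 0) ->
  word l *m Q = Q -> word l *m v = v.
Proof.
move=> lD dQ LQ Qv; have [k] := ubnP (size l); elim: k l lD => // k IHk.
case=> [|a l] lD sl; first by rewrite /= !mul1mx.
have aD : a \in Delta by apply: lD; rewrite mem_head.
have {}lD : {subset l <= Delta} by move=> d dl; apply: lD; rewrite inE dl orbT.
have [sigma [_ sP]] := weylF_perm (weylF_word C l).
have ec := sP a; have [cp|cn] := boolP (positive (sigma a)); last first.
  have [l' [l'D sl' /= ->]] := word_deletion lD (positive_simple aD) ec cn.
  by apply: IHk => //; apply: leq_trans sl' _; rewrite -ltnS ltnW.
rewrite /= => eQ; have aQ : rootF a *m Q = 0.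
  apply: LQ; apply/eqP; rewrite eq_le dQ // andbT.
  rewrite -{1}eQ !mulmxA rootF_sref.
  have -> : rootF (sref a a) = - rootF a.
    by rewrite /rootF sref_self map_mxN.
  by rewrite mulNmx ec mulNmx raddfN oppr_le0 dominant_ge0.
have fixa (m : nat) (x : 'M[C]_(n, m)) : rootF a *m x = 0 -> reflF a *m x = x.
  by move=> ax; rewrite /reflF mulmxBl mul1mx -mulmxA ax mulmx0 subr0.
have lQ : word l *m Q = Q.
  by rewrite -[RHS](fixa _ _ aQ) -{2}eQ !mulmxA reflFK mul1mx.
by rewrite -mulmxA IHk // fixa // Qv.
Qed.

End Dominant.

End Base.

Theorem weylF_stabilizer (R : realType) (n : nat) (D : rootDatum n)
    (Delta : {set D}) (s : nat) (Q : 'M[Cx R]_(n, s)) (w : 'M[Cx R]_n) :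
  is_base Delta -> weylF D w -> w *m Q = Q ->
  forall v : 'cV_n,
  (forall a : D, rootF (Cx R) a *m Q = 0 -> rootF (Cx R) a *m v = 0) ->
  w *m v = v.
Proof.
move=> [Dfree Dcf] Ww wQ v Qv.
have /choice[cf cfP] (b : D) : exists c : D -> int,
    rd_root b = \sum_(a in Delta) c a *: rd_root a /\
    ((forall a, a \in Delta -> 0 <= c a) \/
     (forall a, a \in Delta -> c a <= 0)).
  have [c [->|->]] := Dcf b.
    exists (fun a => Posz (c a)); split; last by left.
    by apply: eq_bigr => a _; rewrite -scaler_nat natz.
  exists (fun a => - Posz (c a)); split; last by right=> a _; rewrite oppr_le0.
  rewrite -sumrN; apply: eq_bigr => a _.
  by rewrite -scaler_nat natz scaleNr.
have cfE b := (cfP b).1; have cf_sign b := (cfP b).2.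
have [sref srefE] := exists_sref D.
have [L LP] := exists_generic_additive (fun a : D => rootF (Cx R) a *m Q).
(* Conjugation by [x] reduces to the dominant type [x *m Q]; genericity of [L] survives because [x]
   permutes the roots. *)
have [x Wx xQ] := exists_dominant Dfree cfE cf_sign srefE L Q.
have [sigma [_ sP]] := weylF_perm Wx.
have ux := weylF_unit Wx.
have Ww1 : weylF D (x *m w *m invmx x).
  by apply: weylFM; [exact: weylFM|exact: weylF_inv].
have [l lD el] := weyl_simple_word Dfree cfE cf_sign srefE Ww1.
have : word (Cx R) l *m (x *m v) = x *m v.
  apply: (word_stabilizer Dfree cfE cf_sign srefE lD xQ).
  - by move=> a; rewrite mulmxA sP; exact: LP.
  - by move=> a; rewrite !mulmxA sP; exact: Qv.
  - by rewrite -el !mulmxA mulmxKV // -mulmxA wQ.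
rewrite -el !mulmxA mulmxKV // -mulmxA.
by move/(can_inj (mulKmx ux)).
Qed.

(** * Admissible deformations and the Weyl group *)

Lemma col_mulmx (F : pzSemiRingType) (m n p : nat) (A : 'M[F]_(m, n))
    (B : 'M[F]_(n, p)) j : col j (A *m B) = A *m col j B.
Proof. by rewrite !colE mulmxA. Qed.

Lemma col_mul_diag (F : comPzSemiRingType) (m n : nat) (A : 'M[F]_(m, n))
    (d : 'rV[F]_n) j : col j (A *m diag_mx d) = d 0 j *: col j A.
Proof. by apply/colP => i; rewrite mul_mx_diag !mxE mulrC. Qed.

Lemma eq_colP (T : Type) (m n : nat) (A B : 'M[T]_(m, n)) :
  (forall j, col j A = col j B) -> A = B.
Proof.
by move=> e; apply/matrixP => i j; move/colP/(_ i): (e j); rewrite !mxE.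
Qed.

Lemma invmx_conjM (F : comUnitRingType) (n : nat) (a b x : 'M[F]_n) :
  a \in unitmx -> b \in unitmx ->
  invmx (a *m b) *m x *m (a *m b) = invmx b *m (invmx a *m x *m a) *m b.
Proof.
move=> ua ub; have uab : a *m b \in unitmx by rewrite unitmx_mul ua.
rewrite -!mulmxA; apply: (can_inj (mulKmx uab)); rewrite mulKVmx // -!mulmxA.
by rewrite (mulKVmx ub) (mulKVmx ua).
Qed.

(** Right multiplication by [z] commutes with [w], so [g] and its conjugate by [w] both send [q] to
    [q *m z]. *)
Lemma commutator_fixes (F : comUnitRingType) (n s : nat) (g w : 'M[F]_n)
    (q : 'M[F]_(n, s)) (z : 'M[F]_s) : g \in unitmx -> w \in unitmx ->
  g *m q = q *m z -> g *m (w *m q) = w *m q *m z ->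
  invmx g *m invmx w *m g *m w *m q = q.
Proof.
move=> ug uw gq gwq; rewrite -!mulmxA gwq -mulmxA (mulKmx uw) -gq.
exact: mulKmx.
Qed.

Lemma commutatorK (F : comUnitRingType) (n s : nat) (g w : 'M[F]_n)
    (q : 'M[F]_(n, s)) : g \in unitmx -> w \in unitmx ->
  w *m (g *m (invmx g *m invmx w *m g *m w *m q)) = g *m (w *m q).
Proof. by move=> ug uw; rewrite -!mulmxA (mulKVmx ug) (mulKVmx uw). Qed.

Lemma eq_leqn (x y : nat) : (forall i, (x <= i)%N = (y <= i)%N) -> x = y.
Proof. by move=> e; apply/eqP; rewrite eqn_leq e leqnn -e leqnn. Qed.

Section Weyl.
Variables (R : realType) (n : nat) (D : rootDatum n).
Local Notation C := (Cx R).
Local Notation t := 'cV[C]_n.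
Local Notation rootC := (@Defs.rootC R n D).
Local Notation weyl := (@Defs.weyl R n D).

Lemma weyl_unit w : weyl w -> w \in unitmx.
Proof. exact: weylF_unit. Qed.

Lemma weyl_inv w : weyl w -> weyl (invmx w).
Proof. exact: weylF_inv. Qed.

Lemma weyl_perm w : weyl w -> exists sigma : D -> D,
  injective sigma /\ forall b, rootC b *m w = rootC (sigma b).
Proof. exact: weylF_perm. Qed.

Lemma finite_weyl : finite_set weyl.
Proof. exact: finite_weylF. Qed.

(** Since phi permutes the roots and preserves t', it also transports coroots; conjugation then
    sends the reflection in [a] to the one in [sigma a]. *)
Lemma outer_aut_normalizes_weyl (Delta : {set D}) phi w :
  outer_aut Delta phi -> weyl w -> weyl (invmx phi *m w *m phi).
Proof.
move=> [uphi _ dphi _ [sigma sP _]] Ww.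
have tr a := reflF_transport uphi dphi sP a.
move: w Ww; apply: weylF_ind => [|a w _ IHw].
  by rewrite mulmx1 mulVmx //; exact: weylF1.
have -> : invmx phi *m (reflF C a *m w) *m phi
    = reflF C (sigma a) *m (invmx phi *m w *m phi).
  rewrite -[reflF C (sigma a)](mulKmx uphi) -tr.
  by rewrite -!mulmxA (mulKVmx uphi).
by apply: weylFM => //; exact: weylF_refl.
Qed.

Section IrregularTypes.
Variable s : nat.
Local Notation irr_type := 'M[C]_(n, s).
Implicit Types Q q : irr_type.

(** Through this dictionary the chain of the phi_i and the pole orders determine each other. The
    shift comes from phi_(i+1) demanding alpha(A_(i+1)) = ... = alpha(A_s) = 0. *)
Lemma in_levi_roots (a : D) Q i :
  (a \in levi_roots D Q i.+1) = (pole_order a Q <= i)%N.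
Proof.
rewrite inE; apply/forallP/idP => [h|/bigmax_leqP h j].
  apply/bigmax_leqP => j; apply: contraNT; rewrite -ltnNge => ij.
  by have := h j; rewrite ij.
by apply/implyP => ij; apply: contraTT ij => /h; rewrite -ltnNge.
Qed.

Lemma pole_order_mul w sigma : (forall b, rootC b *m w = rootC (sigma b)) ->
  forall (a : D) Q, pole_order a (w *m Q) = pole_order (sigma a) Q.
Proof.
move=> sP a Q; apply: eq_bigl => j.
by rewrite col_mulmx mulmxA sP.
Qed.

Lemma col_in_fixed_space Q q i (j : 'I_s) :
  (forall a : D, pole_order a Q = pole_order a q) -> (i <= j)%N ->
  fixed_space (levi_roots D Q i.+1) (col j q).
Proof.
move=> pQ ij a; rewrite in_levi_roots pQ -in_levi_roots inE.
by move=> /forallP/(_ j)/implyP/(_ ij)/eqP.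
Qed.

Lemma fixed_space_levi_mono Q i (v : t) :
  fixed_space (levi_roots D Q i.+1) v -> fixed_space (levi_roots D Q 1) v.
Proof.
move=> h a; rewrite in_levi_roots => a0; apply: h.
by rewrite in_levi_roots (leq_trans a0).
Qed.

(** The columns of [Q] that define the set lie in its fixed space, so vanishing there can be tested
    on them. *)
Lemma levi_roots_fixed_space Q i (a : D) :
  (forall v, fixed_space (levi_roots D Q i.+1) v -> rootC a *m v = 0) ->
  a \in levi_roots D Q i.+1.
Proof.
move=> h; rewrite inE; apply/forallP => j; apply/implyP => ij.
by apply/eqP/h; exact: col_in_fixed_space.
Qed.

Lemma fixes_fixed_space (w : 'M[C]_n) Q q :
  (forall a : D, pole_order a Q = pole_order a q) ->
  (forall v, fixed_space (levi_roots D Q 1) v -> w *m v = v) -> w *m q = q.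
Proof.
move=> pQ wv; apply: eq_colP => j; rewrite col_mulmx.
by apply: wv; apply: col_in_fixed_space pQ (leq0n _).
Qed.

Lemma stabilizer_pointwise_stab (Delta : {set D}) w Q : is_base Delta ->
  weyl w -> w *m Q = Q -> pointwise_stab (levi_roots D Q 1) w.
Proof.
move=> hD Ww wQ; split=> // v vQ.
apply: (weylF_stabilizer hD Ww wQ) => a aQ; apply: vQ; rewrite inE.
apply/forallP => j; apply/implyP => _.
by rewrite colE mulmxA [rootC a *m Q]aQ mul0mx.
Qed.

Definition zeta_diag r : 'M[C]_s := diag_mx (\row_(i < s) zeta R r ^+ i.+1).

Lemma generatesE phi r g' Q : generates D phi r g' Q <->
  weyl g' /\ phi *m g' *m Q = Q *m zeta_diag r.
Proof.
split=> -[Wg' h]; split=> //.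
  by apply: eq_colP => j; rewrite col_mulmx h col_mul_diag mxE.
by move=> i; rewrite -col_mulmx h col_mul_diag mxE.
Qed.

Lemma levi_roots_eq Q q i : (forall a : D, pole_order a Q = pole_order a q) ->
  levi_roots D Q i.+1 = levi_roots D q i.+1.
Proof.
move=> pQ; apply/setP => a; apply: etrans (in_levi_roots a Q i) _.
apply: etrans (esym (in_levi_roots a q i)).
exact (congr1 (fun k => (k <= i)%N) (pQ a)).
Qed.

Lemma pole_order_le (a : D) Q : (pole_order a Q <= s)%N.
Proof. by apply/bigmax_leqP => i _. Qed.

Lemma eq_pole_order Q q :
  (forall i : 'I_s, levi_roots D Q i.+1 = levi_roots D q i.+1) ->
  forall a : D, pole_order a Q = pole_order a q.
Proof.
move=> e a; apply: eq_leqn => i; have [si|lis] := leqP s i.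
  have hQ := leq_trans (pole_order_le a Q) si.
  by have hq := leq_trans (pole_order_le a q) si; exact: etrans hQ (esym hq).
apply: etrans (esym (in_levi_roots a Q i)) _.
apply: etrans (in_levi_roots a q i).
exact (congr1 (fun A : {set D} => a \in A) (e (Ordinal lis))).
Qed.

(** With its converse below, this translates stabilizers of subspaces, in which W(phi) is expressed,
    into invariance of sets of roots, in which pole orders are expressed. *)
Lemma setwise_stab_levi w sigma Q i :
  (forall b, rootC b *m w = rootC (sigma b)) ->
  setwise_stab (levi_roots D Q i.+1) w ->
  forall a, (sigma a \in levi_roots D Q i.+1) = (a \in levi_roots D Q i.+1).
Proof.
move=> sP Nw a; apply/idP/idP => ha; apply: levi_roots_fixed_space => v tv.
  have [_ e] := Nw; move: tv; rewrite -{1}e => -[u tu <-].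
  by rewrite mulmxA sP; exact: tu.
by rewrite -sP -mulmxA; exact: setwise_stab_in Nw tv a ha.
Qed.

Lemma levi_setwise_stab w sigma Q i : weyl w ->
  (forall b, rootC b *m w = rootC (sigma b)) ->
  (forall a, (sigma a \in levi_roots D Q i.+1) = (a \in levi_roots D Q i.+1)) ->
  setwise_stab (levi_roots D Q i.+1) w.
Proof.
move=> Ww sP st; split=> //; apply/seteqP; split=> [_ [v tv <-] a ha|v tv].
  by rewrite mulmxA sP; apply: tv; rewrite st.
have uw := weyl_unit Ww.
exists (invmx w *m v); last by rewrite mulKVmx.
move=> a ha.
have [tau [_ tP]] := weyl_perm (weyl_inv Ww).
rewrite mulmxA tP; apply: tv; rewrite -st; suff -> : sigma (tau a) = a by [].
by apply: (@rootF_inj C); rewrite -[LHS]sP -tP mulmxKV.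
Qed.

Section AdmissibleDeformations.
Variables (Delta : {set D}) (phi : 'M[C]_n) (r : nat) (Q : irr_type).
Variable g' : 'M[C]_n.
Hypotheses (hDelta : is_base Delta) (hphi : outer_aut Delta phi).
Hypothesis hg' : generates D phi r g' Q.
Let g := phi *m g'.

Let uphi : phi \in unitmx. Proof. by case: hphi. Qed.

Let ug : g \in unitmx.
Proof. by rewrite unitmx_mul uphi weyl_unit //; case: hg'. Qed.

Lemma BQP q : BQ D phi r Q q <->
  g *m q = q *m zeta_diag r /\ forall a : D, pole_order a Q = pole_order a q.
Proof.
have /generatesE[Wg' gQ] := hg'.
split=> [[[g2 [/generatesE[Wg2 g2Q]]]]|[gq pq]].
  move=> /generatesE[_ g2q] pq; split=> //; rewrite -g2q /g -!mulmxA.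
  congr (_ *m _).
  have ug2 := weyl_unit Wg2.
  apply: (can_inj (mulKmx (weyl_unit (weyl_inv Wg2)))).
  rewrite mulKmx // mulmxA; apply: (fixes_fixed_space pq).
  (* Both [g2] and [g'] generate the orbit of [Q], so [invmx g2 *m g'] fixes [Q]. *)
  suff : pointwise_stab (levi_roots D Q 1) (invmx g2 *m g') by case.
  apply: (stabilizer_pointwise_stab hDelta); first exact: weylM (weyl_inv _) _.
  rewrite -mulmxA; apply: (can_inj (mulKmx ug2)); rewrite mulKVmx //.
  by apply: (can_inj (mulKmx uphi)); rewrite !mulmxA gQ g2Q.
by split=> //; exists g'; split; apply/generatesE.
Qed.

Lemma BQ_refl : BQ D phi r Q Q.
Proof. by apply/BQP; split=> //; have /generatesE[] := hg'. Qed.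

(** Commutation with [g] holds only on t_phi_i and up to a correction [u], but each column of [q]
    lies in the corresponding space and is fixed by [u], so its eigenvalue equation carries over.
    Stabilizing every t_phi_i preserves the pole orders. *)
Lemma preimZ_BQ w q : preimZ D Q g w -> BQ D phi r Q q -> BQ D phi r Q (w *m q).
Proof.
move=> /preimZP[Ww hw] /BQP[gq pq].
have [sigma [_ sP]] := weyl_perm Ww.
apply/BQP; split.
  apply: eq_colP => i; have [_ [u [_ Ku] c]] := hw i.
  have ti := col_in_fixed_space pq (leqnn i).
  have gi : g *m col i q = zeta R r ^+ i.+1 *: col i q.
    by rewrite -col_mulmx gq col_mul_diag mxE.
  rewrite [RHS]col_mul_diag mxE !col_mulmx -(c _ ti) gi -!scalemxAr.
  by rewrite (Ku _ ti).
apply: eq_pole_order => i; apply/setP => a; have [Nw _] := hw i.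
apply: etrans (esym (setwise_stab_levi sP Nw a)) _.
apply: etrans (etrans (_ : _ = (sigma a \in levi_roots D q i.+1)) _) _.
- exact (congr1 (fun A : {set D} => sigma a \in A) (levi_roots_eq i pq)).
- exact: in_levi_roots.
apply: etrans (esym (in_levi_roots a (w *m q) i)).
exact (congr1 (fun k => (k <= i)%N) (esym (pole_order_mul sP a q))).
Qed.

Lemma BQ_free w q : weyl w -> BQ D phi r Q q -> w *m q = q ->
  pointwise_stab (levi_roots D Q 1) w.
Proof.
move=> Ww /BQP[_ pq] wq.
apply: (eq_ind_r (fun A => pointwise_stab A w) _ (levi_roots_eq 0 pq)).
exact: (stabilizer_pointwise_stab hDelta).
Qed.

Lemma pointwise_stab_BQ u q : pointwise_stab (levi_roots D Q 1) u ->
  BQ D phi r Q q -> u *m q = q.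
Proof. by move=> [_ Ku] /BQP[_ pq]; exact: fixes_fixed_space Ku. Qed.

Lemma BQ_preimZ w q : weyl w -> BQ D phi r Q q -> BQ D phi r Q (w *m q) ->
  preimZ D Q g w.
Proof.
move=> Ww Bq Bwq; have [[gq pq] [gwq pwq]] := ((BQP q).1 Bq, (BQP _).1 Bwq).
have [sigma [_ sP]] := weyl_perm Ww.
have /generatesE[Wg' _] := hg'.
have uw := weyl_unit Ww.
(* As phi normalizes W, so does [g]: the commutator is the product of a [g]-conjugate of [invmx w]
   and [w]. *)
have Wy : weyl (invmx g *m invmx w *m g *m w).
  rewrite (invmx_conjM (invmx w) uphi (weyl_unit Wg')).
  do 2!apply: weylM => //; apply: weylM; first exact: weyl_inv.
  by apply: outer_aut_normalizes_weyl hphi _; exact: weyl_inv.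
have yq := commutator_fixes ug uw gq gwq.
apply/preimZP; split=> // i; split.
  apply: (levi_setwise_stab Ww sP) => a.
  apply: etrans (in_levi_roots (sigma a) Q i) _.
  apply: etrans (esym (in_levi_roots a Q i)).
  apply: (congr1 (fun k => (k <= i)%N)); apply: etrans (pq (sigma a)) _.
  exact (etrans (esym (pole_order_mul sP a q)) (esym (pwq a))).
(* The commutator is trivial on t_phi1, which contains every t_phi_i, so [w] itself commutes with
   [g] there. *)
exists 1%:M => [|v tv]; first exact: pointwise_stab1.
have [_ /(_ v (fixed_space_levi_mono tv)) yv] := BQ_free Wy Bq yq.
rewrite mul1mx -{1}yv.
exact: commutatorK.
Qed.

(** A deformation of another representative [w *m Q] is brought back to [Q]. The conjugate of
    [phi *m g1] by [w] has again the form [phi *m g2] with [g2] in W, because phi normalizes W. *)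
Lemma BQ_conj w q1 q : weyl w -> q1 = w *m Q ->
  adm_equiv D phi r q1 q -> BQ D phi r Q (invmx w *m q).
Proof.
move=> Ww -> [[g1 [/generatesE[Wg1 g1Q] /generatesE[_ g1q]]] pq].
have uw := weyl_unit Ww; have [sigma [_ sP]] := weyl_perm (weyl_inv Ww).
pose g2 := invmx phi *m invmx w *m phi *m g1 *m w.
have Wg2 : weyl g2.
  do 2!apply: weylM => //.
  by apply: outer_aut_normalizes_weyl hphi _; exact: weyl_inv.
have phig2 : phi *m g2 = invmx w *m (phi *m g1) *m w.
  by rewrite /g2 -!mulmxA (mulKVmx uphi).
split.
  exists g2; split; apply/generatesE; split=> //; rewrite phig2.
    by rewrite -(mulmxA _ w) -mulmxA g1Q mulmxA mulKmx.
  by rewrite -(mulmxA _ w) mulKVmx // -mulmxA g1q mulmxA.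
move=> a; apply: etrans _ (esym (pole_order_mul sP a q)).
apply: etrans (pq (sigma a)); apply: etrans (pole_order_mul sP a _).
by rewrite mulKmx.
Qed.

Lemma subgroup_preimZ : subgroup (preimZ D Q g).
Proof.
split=> [|x y|x Px]; [exact: preimZ1|exact: preimZM|].
have Wx := proj1 Px; have ux := weyl_unit Wx; split=> //.
by apply: (preimZV Px (weyl_inv Wx)); rewrite ?mulVmx ?mulmxV.
Qed.

Lemma normal_pointwise_stab : (0 < s)%N ->
  normal_subgroup (pointwise_stab (levi_roots D Q 1)) (preimZ D Q g).
Proof.
move=> s_gt0; split.
- split=> [|x y|x Kx]; [exact: pointwise_stab1|exact: pointwise_stabM|].
  have Wx := proj1 Kx; have ux := weyl_unit Wx; split=> //.
  by apply: (pointwise_stabV Kx (weyl_inv Wx)); rewrite mulVmx.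
- exact: subgroup_preimZ.
(* An element of K fixes [Q], so it carries one point of B(Q) into B(Q) and thus lies in the
   preimage of Z. *)
- move=> u Ku; apply: (@BQ_preimZ u Q); [by case: Ku|exact: BQ_refl|].
  by rewrite (pointwise_stab_BQ Ku BQ_refl); exact: BQ_refl.
- move=> x u Px Ku; have [_ _ /(_ x Px)[ux Pix]] := subgroup_preimZ.
  (* As s > 0, phi_1 is one of the levels, so the inverse of [x] stabilizes t_phi1. *)
  have [_ /(_ (Ordinal s_gt0))[Nix _]] := Pix.
  rewrite -{1}[x]invmxK -[X in _ *m X]/(invmx x).
  apply: (pointwise_stabJ (w := invmx x)) => //;
    rewrite ?invmxK ?mulmxV ?mulVmx //.
  by case: Px.
Qed.

End AdmissibleDeformations.
End IrregularTypes.
End Weyl.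

(** * Quotients by finite free actions *)

Lemma hausdorff_sep (X : topologicalType) (x y : X) : hausdorff_space X ->
  x <> y -> exists U V : set X,
    [/\ open U, open V, U x, V y & forall z, U z -> V z -> False].
Proof.
rewrite open_hausdorff => h /eqP /h[[U V] /= [Ux Vy] [oU oV /eqP UV]].
exists U, V; split; rewrite // ?(set_mem Ux) ?(set_mem Vy) //.
- exact: set_mem Ux.
- exact: set_mem Vy.
- by move=> z Uz Vz; have : (U `&` V) z by []; rewrite UV.
Qed.

Lemma closed_equalizer (X Y : topologicalType) (f g : X -> Y) :
  hausdorff_space Y -> continuous f -> continuous g ->
  closed [set x | f x = g x].
Proof.
move=> hY cf cg; rewrite -openC openE => x /= fgx.
have [U [V [oU oV Ux Vx UV]]] := hausdorff_sep hY fgx.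
have : nbhs x (f @^-1` U `&` g @^-1` V).
  by apply: filterI; [apply: cf|apply: cg]; exact: open_nbhs_nbhs.
by apply: filterS => z [/= Uz Vz] e; apply: (UV (f z)) => //; rewrite e.
Qed.

Section FiniteFreeAction.
Variables (X Y : topologicalType) (p : X -> Y) (A : set (X -> X)).
Hypotheses (hX : hausdorff_space X) (finA : finite_set A).
Hypothesis A_comp : forall f g, A f -> A g -> A (f \o g).
Hypothesis A_inv : forall f, A f -> exists g, [/\ A g, cancel f g & cancel g f].
Hypothesis A_cont : forall f, A f -> continuous f.
Hypothesis A_free : forall f x, A f -> f x = x -> f = id.
Hypothesis p_surj : forall y, exists x, p x = y.
Hypothesis p_quot : forall U : set Y, open U <-> open (p @^-1` U).
Hypothesis p_fibre : forall x y, p x = p y <-> exists2 f, A f & f x = y.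

Lemma action_eq f g x : A f -> A g -> f x = g x -> f = g.
Proof.
move=> Af Ag fgx; have [k [Ak fk kf]] := A_inv Af.
have kg : k \o g = id.
  by apply: (A_free (x := x)); [exact: A_comp|rewrite /= -fgx fk].
by apply/funext => y; rewrite -[RHS]kf; have /= -> := congr1 (@^~ y) kg.
Qed.

Lemma action_image_open f N : A f -> open N -> open (f @` N).
Proof.
move=> Af oN; have [k [Ak fk kf]] := A_inv Af.
suff -> : f @` N = k @^-1` N by move/continuousP: (A_cont Ak); exact.
apply/seteqP; split=> [_ [x Nx <-]|x Nkx] /=; first by rewrite fk.
by exists (k x).
Qed.

Lemma quotient_image_preimage N : p @^-1` (p @` N) = \bigcup_(f in A) (f @` N).
Proof.
apply/seteqP; split=> [y [x Nx /p_fibre[f Af <-]]|_ [f Af [x Nx <-]]].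
  by exists f => //; exists x.
by exists x => //; apply/p_fibre; exists f.
Qed.

Lemma quotient_image_open N : open N -> open (p @` N).
Proof.
move=> oN; apply/p_quot; rewrite quotient_image_preimage.
by apply: bigcup_open => f Af; exact: action_image_open.
Qed.

Lemma quotient_map_continuous : continuous p.
Proof. by apply/continuousP => U; exact: (p_quot U).1. Qed.

Lemma exists_wandering_nbhs x : exists N, [/\ open N, N x &
  forall f y, A f -> N y -> N (f y) -> f = id].
Proof.
have /choice[N NP] (f : X -> X) : exists N : set X, A f ->
    [/\ open N, N x & forall y, N y -> N (f y) -> f = id].
  have [-> | /eqP fid] := eqVneq f id.
    by exists setT => _; split=> //; exact: openT.
  have [Af|nAf] := pselect (A f); last by exists setT.
  have fx : x <> f x by move=> e; apply: fid; apply: (A_free Af (esym e)).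
  have [U [V [oU oV Ux Vx UV]]] := hausdorff_sep hX fx.
  exists (U `&` f @^-1` V) => _; split => //.
    by apply: openI => //; move/continuousP: (A_cont Af); exact.
  by move=> y [_ Vy] [Uy _]; case: (UV (f y)).
(* The intersection of the [N f], written as a complement so that finiteness of [A] enters through a
   finite union of closed sets. *)
exists (~` \bigcup_(f in A) ~` N f); split.
- apply: closed_openC; apply: closed_bigcup => // f Af.
  by apply: open_closedC; case: (NP f Af).
- by move=> [f Af]; case: (NP f Af).
- move=> f y Af nNy nNfy; have [_ _ sep] := NP f Af; apply: (sep y).
    by apply: contrapT => nN; apply: nNy; exists f.
  by apply: contrapT => nN; apply: nNfy; exists f.
Qed.

(** The sheets are the translates of [N], pairwise disjoint since only the identity makes [N] meet
    itself; the inverse on a sheet is continuous because [p] is open. *)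
Lemma quotient_evenly_covered x N : open N -> N x ->
  (forall f y, A f -> N y -> N (f y) -> f = id) ->
  evenly_covered p (p @` N).
Proof.
move=> oN Nx Nsep; have oU := quotient_image_open oN.
exists [set S | exists2 f, A f & S = f @` N]; split.
- by move=> _ [f Af ->]; exact: action_image_open.
- move=> _ _ [f Af ->] [g Ag ->] [_ [[y Ny <-] [z Nz gzfy]]].
  have [k [Ak fk kf]] := A_inv Af; suff -> : f = g by [].
  have kg : k \o g = id.
    apply: (Nsep _ z (A_comp Ak Ag) Nz); rewrite /= gzfy fk //.
  by apply/funext => u; rewrite -[RHS]kf; have /= -> := congr1 (@^~ u) kg.
- rewrite quotient_image_preimage; apply/seteqP.
  split=> [y [_ [f Af ->]] fNy|y [f Af fNy]]; first by exists f.
  by exists (f @` N) => //; exists f.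
move=> _ [f Af ->]; have oS := action_image_open Af oN.
have inj : forall y z, (f @` N) y -> (f @` N) z -> p y = p z -> y = z.
  move=> _ _ [y Ny <-] [z Nz <-] /p_fibre[g Ag gfy].
  have [k [Ak fk kf]] := A_inv Af.
  suff -> : y = z by [].
  have kgf : k \o (g \o f) = id.
    by apply: (Nsep _ y) => //; [do 2!apply: A_comp => //|rewrite /= gfy fk].
  by have /= := congr1 (@^~ y) kgf; rewrite gfy fk.
have onto y : (p @` N) y -> exists2 z, (f @` N) z & p z = y.
  move=> [z Nz <-]; exists (f z); first by exists z.
  by apply/esym/p_fibre; exists f.
split.
- split.
  + move=> _ [y Ny <-]; exists y => //; apply/p_fibre; by exists f.
  + by move=> y z /set_mem Sy /set_mem Sz; exact: inj.
  + by move=> y /onto.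
- exact: continuous_subspaceT quotient_map_continuous.
have /choice[q qP] (y : Y) : exists z, (p @` N) y -> (f @` N) z /\ p z = y.
  have [/onto[z Sz pz]|ny] := pselect ((p @` N) y); last by exists x.
  by exists z.
exists q; split; last first.
  move=> z Sz; have Upz : (p @` N) (p z).
    by case: Sz => u Nu <-; exists u => //; apply/p_fibre; exists f.
  by have [Sq pq] := qP _ Upz; exact: inj.
rewrite (continuous_open_subspace _ oU); apply/(continuous_inP _ oU) => O oO.
suff -> : p @` N `&` q @^-1` O = p @` (f @` N `&` O).
  by apply: quotient_image_open; exact: openI.
apply/seteqP; split=> [y [/qP[Sq pq] Oq]|_ [z [Sz Oz] <-]].
  by exists (q y).
have Upz : (p @` N) (p z).
  by case: Sz => u Nu <-; exists u => //; apply/p_fibre; exists f.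
split=> //=; have [Sq pq] := qP _ Upz; by rewrite (inj _ _ Sq Sz pq).
Qed.

Lemma quotient_covering_map : covering_map p.
Proof.
split; first exact: quotient_map_continuous.
  by move=> y _; have [x <-] := p_surj y; exists x.
move=> y; have [x <-] := p_surj y.
have [N [oN Nx Nsep]] := exists_wandering_nbhs x.
exists (p @` N); split; first exact: quotient_image_open.
  by exists x.
exact: (quotient_evenly_covered oN Nx Nsep).
Qed.

Lemma action_deck f : A f -> deck p f.
Proof.
move=> Af; have [k [Ak fk kf]] := A_inv Af; split.
  by split; [exact: A_cont|exists k; split=> //; exact: A_cont].
by move=> x; apply/esym/p_fibre; exists f.
Qed.

Lemma quotient_galois_covering : connected [set: X] -> galois_covering p.
Proof.
move=> cX; split=> //; first exact: quotient_covering_map.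
by move=> x y /p_fibre[f Af fx]; exists f => //; exact: action_deck.
Qed.

(* A deck transformation agrees with some element of A at each point, hence,
   by connectedness, with a single one everywhere. *)
Lemma quotient_deck (x0 : X) : connected [set: X] -> deck p = A.
Proof.
move=> cX; apply/seteqP; split=> [h [[ch _] ph]|f]; last exact: action_deck.
pose E f := [set x | h x = f x].
have clE f : A f -> closed (E f).
  by move=> Af; apply: closed_equalizer => //; exact: A_cont.
have hA x : exists2 f, A f & E f x.
  by have /p_fibre[f Af fx] := esym (ph x); exists f.
have [f Af Ef0] := hA x0; suff Ef : E f = setT.
  suff -> : h = f by [].
  by apply/funext => x; have : E f x by rewrite Ef.
apply: cX; first by exists x0.
(* By freeness the closed sets [E g] are disjoint, and they cover the space; [E f] is the complement
   of finitely many of them, hence open. *)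
- exists (~` \bigcup_(g in A `\ f) E g).
    apply: closed_openC; apply: closed_bigcup; first exact: finite_setD.
    by move=> g [Ag _]; exact: clE.
  rewrite setTI; apply/seteqP; split=> [x Efx [g [Ag gf] Egx]|x nE].
    by apply: gf; apply: (@action_eq g f x) => //; rewrite -Egx.
  have [g Ag Egx] := hA x; have [<-//|/eqP gf] := eqVneq g f.
  by case: nE; exists g.
- by exists (E f); [exact: clE|rewrite setTI].
Qed.

End FiniteFreeAction.

(** * Complex matrices and paths *)

Lemma connected_set_type (X : topologicalType) (B : set X) :
  connected B -> connected [set: B].
Proof.
move=> cB E [e Ee] [G oG]; rewrite setTI => EG [F cF]; rewrite setTI => EF.
have {oG} [U oU UE] := oG.
have : open (~` F) by exact: closed_openC.
move=> [V oV VE].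
have EB : set_val @` E = B.
  apply: cB; first by exists (set_val e); exists e.
  - exists U => //; apply/seteqP; split=> [_ [x Ex <-]|x [Bx Ux]].
      split; first exact: set_valP.
      by move: Ex; rewrite EG -UE.
    exists (SigSub (mem_set Bx)) => //; rewrite EG -UE //.
  - exists (~` V); first exact: open_closedC.
    apply/seteqP; split=> [_ [x Ex <-]|x [Bx nVx]].
      split; first exact: set_valP.
      move=> Vx; have : (~` F) x by rewrite -VE.
      by apply; rewrite -EF.
    exists (SigSub (mem_set Bx)) => //; rewrite EF.
    apply: contrapT => nF; apply: nVx.
    by have : (set_val @^-1` V) (SigSub (mem_set Bx)) by rewrite VE.
apply/seteqP; split=> // x _.
have Bx : B (set_val x) by exact: set_valP.
have [y Ey /val_inj <- //] : (set_val @` E) (set_val x).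
by apply: (eq_ind_r (fun A : set X => A (set_val x)) Bx EB).
Qed.

Lemma hausdorff_separating (X Y : topologicalType) : hausdorff_space Y ->
  (forall x y : X, x <> y -> exists2 f : X -> Y, continuous f & f x <> f y) ->
  hausdorff_space X.
Proof.
move=> hY sepX; rewrite open_hausdorff => x y /eqP/sepX[f cf fxy].
have [U [V [oU oV Ux Vy UV]]] := hausdorff_sep hY fxy.
exists (f @^-1` U, f @^-1` V); first by split; apply/mem_set.
split; [by move/continuousP: cf; exact|by move/continuousP: cf; exact|].
by apply/eqP/seteqP; split=> // z [Uz Vz]; exact: UV Uz Vz.
Qed.

Lemma hausdorff_set_type (X : topologicalType) (B : set X) :
  hausdorff_space X -> hausdorff_space B.
Proof.
move=> hX; apply: (hausdorff_separating hX) => x y xy.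
exists set_val; first exact: initial_continuous.
by move/val_inj.
Qed.

Section MatrixTopology.
Variable K : numFieldType.

Lemma hausdorff_matrix m n : hausdorff_space 'M[K]_(m, n).
Proof.
apply: (@hausdorff_separating _ K); first exact: (@norm_hausdorff K K).
move=> x y xy; apply: contrapT => h; apply: xy; apply/matrixP => i j.
apply: contrapT => xyij; apply: h; exists (fun M : 'M[K]_(m, n) => M i j) => //.
exact: coord_continuous.
Qed.

Lemma continuous_matrix (X : topologicalType) m n (f : X -> 'M[K]_(m, n)) :
  (forall i j, continuous (fun x => f x i j)) -> continuous f.
Proof.
move=> cf x A [P Px sPA]; rewrite nbhs_simpl.
have : \forall y \near x, forall i j, P i j (f y i j).
  apply: filter_forall => i; apply: filter_forall => j.
  exact: (cf i j x _ (Px i j)).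
by apply: filterS => y Py; exact: sPA.
Qed.

Lemma continuous_sumr (X : topologicalType) (I : Type) (r : seq I)
    (f : I -> X -> K) :
  (forall i, continuous (f i)) -> continuous (fun x => \sum_(i <- r) f i x).
Proof.
by move=> cf; apply: continuous_big => //; exact: (@add_continuous K).
Qed.

Lemma mulmx_continuous m n p (A : 'M[K]_(m, n)) :
  continuous (fun B : 'M[K]_(n, p) => A *m B).
Proof.
apply: continuous_matrix => i j.
rewrite (_ : (fun _ => _) =
    (fun B : 'M[K]_(n, p) => \sum_k A i k * B k j)); last first.
  by apply/funext => B; rewrite mxE.
apply: continuous_sumr => k B.
apply: (@continuous_comp _ _ _ (fun M : 'M[K]_(n, p) => M k j) ( *%R (A i k))).
  exact: coord_continuous.
exact: mulrl_continuous.
Qed.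

Lemma mulmxr_continuous m n p (A : 'M[K]_(n, p)) :
  continuous (fun B : 'M[K]_(m, n) => B *m A).
Proof.
apply: continuous_matrix => i j.
rewrite (_ : (fun _ => _) =
    (fun B : 'M[K]_(m, n) => \sum_k A k j * B i k)); last first.
  by apply/funext => B; rewrite mxE; apply: eq_bigr => k _; rewrite mulrC.
apply: continuous_sumr => k B.
apply: (@continuous_comp _ _ _ (fun M : 'M[K]_(m, n) => M i k) ( *%R (A k j))).
  exact: coord_continuous.
exact: mulrl_continuous.
Qed.

Lemma affine_line_continuous (X : topologicalType) m n (z : X -> K)
    (x d : 'M[K]_(m, n)) : continuous z -> continuous (fun u => x + z u *: d).
Proof.
move=> cz; apply: continuous_matrix => i j u.
rewrite (_ : (fun _ => _) = (fun u => x i j + z u * d i j)); last first.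
  by apply/funext => v; rewrite !mxE.
by apply: cvgD; [exact: cvg_cst|apply: cvgM; [exact: cz|exact: cvg_cst]].
Qed.

End MatrixTopology.

(** * Arcs in the complex line avoiding finitely many points *)

Section ComplexPaths.
Variable R : realType.
Local Notation C := (Cx R).

Definition of_real (x : R) : C := (x%:C)%C.

Lemma of_real_continuous : continuous of_real.
Proof.
move=> x; apply/cvgrPdist_lt => e e0.
have e0' : 0 < complex.Re (e : R[i]) by move: e0; rewrite ltcE /= => /andP[].
near=> y.
have -> : of_real x - of_real y = of_real (x - y) by rewrite /of_real rmorphB.
have -> : `|of_real (x - y)| = of_real `|x - y|.
  by rewrite /of_real normc_def /= expr0n addr0 sqrtr_sqr.
rewrite ltcE /=; apply/andP; split.
  by move: e0; rewrite ltcE /= => /andP[].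
near: y; exact: cvgr_dist_lt.
Unshelve. all: by end_near.
Qed.

(** A parabolic arc from 0 to 1; arcs with different bends [c] meet only at these two points. *)
Definition bent_path (c t : R) : C :=
  of_real t + (0 +i* 1)%C * of_real (c * (t * (1 - t))).

Lemma bent_pathE c t : bent_path c t = (t +i* (c * (t * (1 - t))))%C.
Proof. by rewrite /bent_path /of_real; simpc; rewrite ?add0r ?addr0. Qed.

Lemma bent_path_continuous c : continuous (bent_path c).
Proof.
move=> t; apply: cvgD; first exact: of_real_continuous.
apply: cvgM; first exact: cvg_cst.
apply: (@continuous_comp _ _ _ (fun t : R => c * (t * (1 - t))) of_real).
  apply: cvgM; first exact: cvg_cst.
  apply: cvgM; first exact: cvg_id.
  by apply: cvgB; [exact: cvg_cst|exact: cvg_id].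
exact: of_real_continuous.
Qed.

(* Each excluded point of the line lies on at most one of the paths. *)
Lemma exists_avoiding_path (I : finType) (u v : I -> C) :
  (forall k, u k != 0) -> (forall k, v k != 0) ->
  exists c, forall t k, u k + bent_path c t * (v k - u k) != 0.
Proof.
(* [w k] is the parameter at which the [k]-th affine function vanishes, and [bad k] the bend of the
   arc through it; the chosen bend exceeds them all. At the endpoints the values are [u k] and
   [v k], nonzero by hypothesis. *)
move=> u0 v0; pose w k : R[i] := u k / (u k - v k).
pose bad k := complex.Im (w k) / (complex.Re (w k) * (1 - complex.Re (w k))).
exists (1 + \sum_k `|bad k|) => t k; apply/negP => /eqP e.
set c := 1 + _ in e.
have uv : u k - v k != 0.
  apply: contra (u0 k) => /eqP uv.
  have vu : v k - u k = 0 by rewrite -opprB uv oppr0.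
  by rewrite -e vu mulr0 addr0.
have ew : bent_path c t = w k.
  apply: (mulIf uv); rewrite /w mulfVK // -opprB mulrN.
  by apply/esym/eqP; rewrite -addr_eq0 e.
have c_bad : c != bad k.
  rewrite gt_eqF // /c (bigD1 k) //= addrA ltr_wpDr ?sumr_ge0 //.
  by rewrite -[ltLHS]add0r ltr_leD // ler_norm.
have [t01|t01] := eqVneq (t * (1 - t)) 0.
  have : w k = 0 \/ w k = 1.
    rewrite -ew bent_pathE t01 mulr0; move/eqP: t01; rewrite mulf_eq0 subr_eq0.
    by case/orP => /eqP e01; [left; rewrite e01|right; rewrite -e01].
  rewrite /w => -[/eqP|/(canRL (divfK uv))/eqP].
    by rewrite mulf_eq0 invr_eq0 (negbTE (u0 k)) (negbTE uv).
  rewrite mul1r eq_sym subr_eq -subr_eq0 opprD addNKr oppr_eq0.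
  by rewrite (negbTE (v0 k)).
case/eqP: c_bad; rewrite /bad -ew bent_pathE /=.
by rewrite mulfK.
Qed.

End ComplexPaths.

(** * Connectedness and closure of the strata *)

Lemma mul_row_col_eq0 (F : pzSemiRingType) (n s : nat) (u : 'rV[F]_n)
    (q : 'M[F]_(n, s)) j : (u *m col j q == 0) = ((u *m q) 0 j == 0).
Proof.
apply/eqP/eqP => [/matrixP/(_ 0 0)|e].
  by rewrite -col_mulmx !mxE.
by rewrite -col_mulmx; apply/matrixP => i k; rewrite !ord1 [RHS]mxE -e mxE.
Qed.

Lemma eq_of_leq_sum (I : finType) (f d : I -> nat) :
  (forall i, f i <= d i)%N -> (\sum_i f i = \sum_i d i)%N ->
  forall i, f i = d i.
Proof.
move=> le e i; have [_] := leqif_sum (fun i (_ : true) => leqif_eq (le i)).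
by rewrite e eqxx => /esym/forallP/(_ i)/eqP.
Qed.

(** * The last index satisfying a predicate *)

Section LastIndex.
Variables (s : nat).
Implicit Types P : pred 'I_s.

Lemma bigmax_ord_le P (j : 'I_s) : (\max_(i | P i) i.+1 <= j)%N -> ~~ P j.
Proof. by move/bigmax_leqP => h; apply/negP => /h; rewrite ltnn. Qed.

Lemma bigmax_ord_attained P (j : 'I_s) : \max_(i | P i) i.+1 = j.+1 -> P j.
Proof.
move=> e; apply: contraT => nPj.
suff : (\max_(i | P i) i.+1 <= j)%N by rewrite e ltnn.
apply/bigmax_leqP => k Pk; rewrite ltn_neqAle; apply/andP; split.
  by apply: contra nPj => /eqP kj; rewrite -(val_inj kj : k = j).
by rewrite -ltnS -e (leq_bigmax_cond (F := fun i : 'I_s => i.+1)).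
Qed.

(** Failure of [P'] beyond the maximum bounds it above, and [P'] at the attained index bounds it
    below; a maximum equal to 0 has no attained index and asks for nothing there. *)
Lemma eq_bigmax_ord P P' :
  (forall j : 'I_s, (\max_(i | P i) i.+1 <= j)%N -> ~~ P' j) ->
  (forall j : 'I_s, \max_(i | P i) i.+1 = j.+1 -> P' j) ->
  \max_(i | P i) i.+1 = \max_(i | P' i) i.+1.
Proof.
move=> h0 h1; apply/eqP; rewrite eqn_leq; apply/andP; split; last first.
  apply/bigmax_leqP => k Pk; rewrite ltnNge; apply: contraL Pk; exact: h0.
case em : (\max_(i | P i) i.+1) => [//|m].
have ms : (m < s)%N by rewrite -em; apply/bigmax_leqP => k _.
exact: (leq_bigmax_cond (F := fun i : 'I_s => i.+1) _ (h1 (Ordinal ms) em)).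
Qed.

End LastIndex.

Section Strata.
Variables (R : realType) (n : nat) (D : rootDatum n) (s : nat).
Local Notation C := (Cx R).
Local Notation rootC := (@Defs.rootC R n D).
Local Notation weyl := (@Defs.weyl R n D).
Local Notation irr_type := 'M[C]_(n, s).
Implicit Types Q q : irr_type.

Lemma pole_orderE (a : D) q :
  pole_order a q = \max_(i < s | (rootC a *m q) 0 i != 0) i.+1.
Proof. by apply: eq_bigl => j; congr (~~ _); exact: mul_row_col_eq0. Qed.

Lemma pole_order_le_eq0 (a : D) q (j : 'I_s) : (pole_order a q <= j)%N ->
  (rootC a *m q) 0 j = 0.
Proof.
by rewrite pole_orderE => /bigmax_ord_le; rewrite negbK => /eqP.
Qed.

Lemma pole_order_neq0 (a : D) q (j : 'I_s) : pole_order a q = j.+1 ->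
  (rootC a *m q) 0 j != 0.
Proof. by rewrite pole_orderE => /bigmax_ord_attained. Qed.

Lemma eq_pole_orderP (a : D) Q q :
  (forall j : 'I_s, (pole_order a Q <= j)%N -> (rootC a *m q) 0 j = 0) ->
  (forall j : 'I_s, pole_order a Q = j.+1 -> (rootC a *m q) 0 j != 0) ->
  pole_order a Q = pole_order a q.
Proof.
move=> h0 h1; apply: etrans (esym (pole_orderE a q)).
apply: etrans (pole_orderE a Q) _; apply: eq_bigmax_ord => j ej.
  by rewrite negbK; apply/eqP/h0; apply: leq_trans ej; rewrite pole_orderE.
by apply: h1; apply: etrans (pole_orderE a Q) ej.
Qed.

Lemma le_pole_order (a : D) q (d : nat) :
  (forall j : 'I_s, (d <= j)%N -> (rootC a *m q) 0 j = 0) ->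
  (pole_order a q <= d)%N.
Proof.
move=> h; rewrite pole_orderE; apply/bigmax_leqP => j; rewrite ltnNge.
by apply: contraNN => /h ->.
Qed.

Section AdmissibleDeformations.
Variables (Delta : {set D}) (phi : 'M[C]_n) (r : nat) (Q : irr_type).
Variable g' : 'M[C]_n.
Hypotheses (hDelta : is_base Delta) (hphi : outer_aut Delta phi).
Hypothesis hg' : generates D phi r g' Q.
Local Notation B := (BQ D phi r Q).

Definition closed_stratum : set irr_type :=
  [set q | phi *m g' *m q = q *m zeta_diag R s r /\
     forall (a : D) (j : 'I_s), (pole_order a Q <= j)%N ->
       (rootC a *m q) 0 j = 0].

Lemma BQ_closed_stratum q : B q -> closed_stratum q.
Proof.
move=> /(BQP hDelta hphi hg')[gq pq]; split=> // a j.
by rewrite pq; exact: pole_order_le_eq0.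
Qed.

Lemma closed_stratum_closed : closed closed_stratum.
Proof.
have -> : closed_stratum =
    [set q | phi *m g' *m q = q *m zeta_diag R s r] `&`
    \bigcap_(aj in [set aj : D * 'I_s | (pole_order aj.1 Q <= aj.2)%N])
      [set q | (rootC aj.1 *m q) 0 aj.2 = 0].
  apply/seteqP; split=> [q [gq h]|q [gq h]]; split=> //.
    by move=> [a j] /=; exact: h.
  by move=> a j ajQ; exact: (h (a, j)).
apply: closedI.
  apply: closed_equalizer; first exact: hausdorff_matrix.
    exact: mulmx_continuous.
  exact: mulmxr_continuous.
apply: closed_bigI => -[a j] /= _.
apply: (@closed_equalizer _ C (fun q => (rootC a *m q) 0 j) (fun=> 0)).
- exact: (@norm_hausdorff C C).
- move=> q.
  apply: (@continuous_comp _ _ _ (fun q : 'M[C]_(n, s) => rootC a *m q)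
    (fun M : 'M[C]_(1, s) => M 0 j)).
    exact: mulmx_continuous.
  exact: coord_continuous.
- by move=> q; exact: cst_continuous.
Qed.

(* On the closed stratum the pole orders can only drop, whereas their sum is
   invariant under the Weyl group, which permutes the roots. *)
Lemma closed_stratum_weyl_BQ w q : weyl w -> B q -> closed_stratum (w *m q) ->
  B (w *m q).
Proof.
move=> Ww Bq [gwq h]; have [_ pq] := (BQP hDelta hphi hg' q).1 Bq.
apply/(BQP hDelta hphi hg'); split; first exact: gwq.
move=> a.
have [sigma [si sP]] := weyl_perm Ww.
pose d (b : D) := pole_order b Q.
have le (b : D) : (pole_order b (w *m q) <= d b)%N.
  by apply: le_pole_order => j; exact: h.
have sumE : (\sum_(b : D) pole_order b (w *m q)%R = \sum_b d b)%N.
  rewrite [RHS](reindex_inj si); apply: eq_bigr => b _.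
  exact (etrans (pole_order_mul sP b q) (esym (pq (sigma b)))).
exact (esym (eq_of_leq_sum le sumE a)).
Qed.

Lemma BQ_line q q' : B q -> B q' -> exists c : R,
  forall t, B (q + bent_path c t *: (q' - q)).
Proof.
move=> Bq Bq'; have [gq pq] := (BQP hDelta hphi hg' q).1 Bq.
have [gq' pq'] := (BQP hDelta hphi hg' q').1 Bq'.
(* Only the leading coefficient of each root has to stay nonzero; the default 1 makes every other
   pair harmless. *)
pose u (x : irr_type) (aj : D * 'I_s) :=
  if pole_order aj.1 Q == aj.2.+1 then (rootC aj.1 *m x) 0 aj.2 else 1.
have u0 x : (forall a : D, pole_order a Q = pole_order a x) ->
    forall aj, u x aj != 0.
  move=> px [a j]; rewrite /u /=.
  case: ifP => [/eqP e|_]; last exact: oner_neq0.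
  by apply: pole_order_neq0; exact: etrans (esym (px a)) e.
have [c cP] := exists_avoiding_path (u0 q pq) (u0 q' pq').
exists c => t; apply/(BQP hDelta hphi hg'); set z := bent_path c t.
have lineE a j : (rootC a *m (q + z *: (q' - q))) 0 j =
    (rootC a *m q) 0 j + z * ((rootC a *m q') 0 j - (rootC a *m q) 0 j).
  rewrite mulmxDr -scalemxAr mulmxBr.
  by move: (rootC a *m q) (rootC a *m q') => x y; rewrite !mxE.
split.
  by rewrite mulmxDr mulmxDl gq -scalemxAr -scalemxAl mulmxBr mulmxBl gq gq'.
move=> a; apply: eq_pole_orderP => j ej; rewrite lineE.
  have [_ /(_ a j ej) ->] := BQ_closed_stratum Bq.
  have [_ /(_ a j ej) ->] := BQ_closed_stratum Bq'.
  by rewrite subrr mulr0 addr0.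
by have := cP t (a, j); rewrite /u /= ej eqxx.
Qed.

Lemma connected_BQ : connected B.
Proof.
have BQQ := BQ_refl hDelta hphi hg'.
have /choice[c cP] (q : irr_type) : exists c : R, B q ->
    forall t, B (Q + bent_path c t *: (q - Q)).
  have [Bq|nBq] := pselect (B q); last by exists 0 => Bq; case: (nBq Bq).
  by have [c cP] := BQ_line BQQ Bq; exists c.
pose path q (t : R) := Q + bent_path (c q) t *: (q - Q).
have -> : B = \bigcup_(q in B) (path q @` `[0, 1]).
  apply/seteqP; split=> [q Bq|_ [q Bq [t _ <-]]]; last exact: cP.
  exists q => //; exists 1; first by rewrite /= in_itv /= ler01 lexx.
  by rewrite /path bent_pathE subrr !mulr0 scale1r addrC subrK.
apply: bigcup_connected => [|q Bq].
  exists Q => q Bq; exists 0; first by rewrite /= in_itv /= ler01 lexx.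
  by rewrite /path bent_pathE mul0r mulr0 scale0r addr0.
apply: connected_continuous_connected; first exact: segment_connected.
apply: continuous_subspaceT; apply: affine_line_continuous.
exact: bent_path_continuous.
Qed.

End AdmissibleDeformations.
End Strata.

(** * The covering and the space of classes *)

Section Quotient.
Variables (R : realType) (n : nat) (D : rootDatum n) (s : nat).
Local Notation C := (Cx R).
Local Notation irr_type := 'M[C]_(n, s).
Variables (Delta : {set D}) (phi : 'M[C]_n) (r : nat) (Q : irr_type).
Variable g' : 'M[C]_n.
Hypotheses (hDelta : is_base Delta) (hphi : outer_aut Delta phi).
Hypothesis hg' : generates D phi r g' Q.
Hypothesis s_gt0 : (0 < s)%N.
Local Notation B := (BQ D phi r Q).
Local Notation P := (preimZ D Q (phi *m g')).
Local Notation K := (@pointwise_stab R n D (levi_roots D Q 1)).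
Local Notation Z := (Zgroup D Q (phi *m g')).
Local Notation Y := (orbit_space D phi r Q g').
Local Notation Th := (irr_class_of D Q).
Local Notation cl := (@irr_class_of R n D s).
Let p : B -> Y := orbit_map g'.

Let x0 : B := SigSub (mem_set (BQ_refl hDelta hphi hg')).

Definition acts_by (w : 'M[C]_n) (f : B -> B) : Prop :=
  forall q, set_val (f q) = w *m set_val q.

Lemma exists_acts_by w : P w -> exists f, acts_by w f.
Proof.
move=> Pw.
exists (fun q => SigSub (mem_set (preimZ_BQ hDelta hphi hg' Pw (set_valP q)))).
by [].
Qed.

Lemma acts_by_eq w f f' : acts_by w f -> acts_by w f' -> f = f'.
Proof.
by move=> h h'; apply/funext => q; apply/val_inj; rewrite [LHS]h [RHS]h'.
Qed.

(** The group Z seen as a set of self-maps of B(Q): elements of [P] in the same coset of K give the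
    same map, so freeness takes the form [f = id]. *)
Definition orbit_action : set (B -> B) :=
  [set f | exists2 w, P w & acts_by w f].

Lemma acts_by_comp w w' f f' : acts_by w f -> acts_by w' f' ->
  acts_by (w *m w') (f \o f').
Proof. by move=> h h' q; rewrite /= h h' mulmxA. Qed.

Lemma orbit_action_comp f f' : orbit_action f -> orbit_action f' ->
  orbit_action (f \o f').
Proof.
move=> [w Pw h] [w' Pw' h']; exists (w *m w'); first exact: preimZM.
exact: acts_by_comp.
Qed.

Lemma preimZ_unit w : P w -> w \in unitmx.
Proof. by case=> Ww _; exact: (weyl_unit Ww). Qed.

Lemma preimZ_inv w : P w -> P (invmx w).
Proof.
have [_ _ h] : subgroup P by exact: subgroup_preimZ.
by case/h.
Qed.

Lemma orbit_action_inv f : orbit_action f ->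
  exists k, [/\ orbit_action k, cancel f k & cancel k f].
Proof.
move=> [w Pw h]; have [k hk] := exists_acts_by (preimZ_inv Pw).
have uw := preimZ_unit Pw.
exists k; split; first by exists (invmx w) => //; exact: preimZ_inv.
  by move=> q; apply/val_inj; rewrite [LHS]hk h mulKmx.
by move=> q; apply/val_inj; rewrite [LHS]h hk mulKVmx.
Qed.

Lemma orbit_action_continuous f : orbit_action f -> continuous f.
Proof.
move=> [w _ h].
apply: (@continuous_comp_initial B B irr_type set_val f).
rewrite (_ : set_val \o f = mulmx w \o set_val); last exact/funext.
move=> q; apply: continuous_comp; first exact: initial_continuous.
exact: mulmx_continuous.
Qed.

Lemma pointwise_stab_acts_by w f : K w -> acts_by w f -> f = id.
Proof.
move=> Kw h; apply/funext => q; apply/val_inj; rewrite [LHS]h.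
exact: (pointwise_stab_BQ hDelta hphi hg' Kw (set_valP q)).
Qed.

Lemma orbit_action_free f q : orbit_action f -> f q = q -> f = id.
Proof.
move=> [w [Ww _] h] fq; apply: (pointwise_stab_acts_by _ h).
apply: (BQ_free hDelta hphi hg' Ww (set_valP q)).
by have := h q; rewrite fq.
Qed.

Lemma finite_orbit_action : finite_set orbit_action.
Proof.
have /choice[F FP] (w : 'M[C]_n) : exists f, P w -> acts_by w f.
  have [Pw|nPw] := pselect (P w); last by exists id => Pw; case: (nPw Pw).
  by have [f h] := exists_acts_by Pw; exists f.
apply: (@sub_finite_set _ _ (F @` (@weyl R n D))).
  move=> f [w Pw h]; exists w; first by case: Pw.
  exact: acts_by_eq (FP w Pw) h.
by apply: finite_image; exact: finite_weyl.
Qed.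

Lemma orbit_mapP q q' : p q = p q' <-> exists2 f, orbit_action f & f q = q'.
Proof.
split=> [/eqquotP/asboolP[w Pw e]|[f [w Pw h] <-]].
  have [f h] := exists_acts_by Pw; exists f; first by exists w.
  by apply/val_inj; exact: etrans (h q) (esym e).
by apply/eqquotP/asboolP; exists w.
Qed.

Lemma orbit_map_surj y : exists q, p q = y.
Proof. by exists (repr y); exact: reprK. Qed.

Lemma orbit_map_quotient (U : set Y) : open U <-> open (p @^-1` U).
Proof. by []. Qed.

Lemma hausdorff_BQ : hausdorff_space B.
Proof. by apply: hausdorff_set_type; exact: hausdorff_matrix. Qed.

Lemma connected_BQ_type : connected [set: B].
Proof. by apply: connected_set_type; exact: connected_BQ hDelta hphi hg'. Qed.

Lemma galois_covering_orbit_map : galois_covering p.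
Proof.
apply: (@quotient_galois_covering _ _ p orbit_action) connected_BQ_type.
- exact: hausdorff_BQ.
- exact: finite_orbit_action.
- exact: orbit_action_comp.
- exact: orbit_action_inv.
- exact: orbit_action_continuous.
- exact: orbit_action_free.
- exact: orbit_map_surj.
- exact: orbit_map_quotient.
- exact: orbit_mapP.
Qed.

Lemma deck_orbit_map : deck p = orbit_action.
Proof.
apply: (@quotient_deck _ _ p orbit_action _ _ _ _ _ _ _ x0 connected_BQ_type).
- exact: hausdorff_BQ.
- exact: finite_orbit_action.
- exact: orbit_action_comp.
- exact: orbit_action_inv.
- exact: orbit_action_continuous.
- exact: orbit_action_free.
- exact: orbit_mapP.
Qed.

(** * The deck group as the quotient of [P] by K *)

Lemma left_coset_refl w : left_coset K w w.
Proof. by exists 1%:M; [exact: pointwise_stab1|rewrite mulmx1]. Qed.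

Lemma left_coset_sub w w' : K (invmx w *m w') -> w \in unitmx ->
  left_coset K w' `<=` left_coset K w.
Proof.
move=> Kww uw _ [u Ku <-]; exists (invmx w *m w' *m u).
  exact: pointwise_stabM.
by rewrite !mulmxA mulmxV // mul1mx.
Qed.

(** Two elements agreeing at the single point [Q] differ by an element fixing it, which lies in K by
    freeness. This makes [rho] injective. *)
Lemma left_coset_eq w w' : P w -> P w' -> w *m Q = w' *m Q ->
  left_coset K w = left_coset K w'.
Proof.
move=> Pw Pw' e; have uw := preimZ_unit Pw; have uw' := preimZ_unit Pw'.
have stab a b : P a -> P b -> a *m Q = b *m Q -> K (invmx a *m b).
  move=> Pa Pb ab; have ua := preimZ_unit Pa.
  apply: (BQ_free hDelta hphi hg' _ (BQ_refl hDelta hphi hg')).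
    by apply: weylM; [exact: (preimZ_inv Pa).1|exact: Pb.1].
  by rewrite -mulmxA -ab mulKmx.
by apply/seteqP; split; apply: left_coset_sub => //; exact: stab.
Qed.

Lemma left_coset_mulE w w' : P w -> P w' ->
  left_coset_mul (left_coset K w) (left_coset K w') = left_coset K (w *m w').
Proof.
move=> Pw Pw'; have uw' := preimZ_unit Pw'.
have [_ _ _ nK] := normal_pointwise_stab hDelta hphi hg' s_gt0.
apply/seteqP; split=> [_ [_ [_ [[u Ku <-] [u' Ku' <-] ->]]]|_ [u Ku <-]].
  exists (invmx w' *m u *m w' *m u').
    apply: pointwise_stabM => //; have := nK _ _ (preimZ_inv Pw') Ku.
    by rewrite invmxK.
  by rewrite -!mulmxA (mulKVmx uw').
exists w, (w' *m u); split; [exact: left_coset_refl|by exists u|].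
by rewrite mulmxA.
Qed.

Lemma exists_deck_action : exists rho : set 'M[C]_n -> B -> B,
  [/\ (forall X w q, Z X -> X w -> set_val (rho X q) = w *m set_val q),
      (forall X X', Z X -> Z X' -> rho (left_coset_mul X X') = rho X \o rho X')
    & set_bij Z (deck p) rho].
Proof.
have /choice[rho rhoP] (X : set 'M[C]_n) : exists f : B -> B,
    Z X -> forall w, X w -> acts_by w f.
  (* Outside Z the identity is a default value. On Z any representative defines the same map, as K
     acts trivially on B(Q). *)
  have [ZX|nZX] := pselect (Z X); last by exists id => ZX; case: (nZX ZX).
  have [w Pw eX] := ZX; have [f h] := exists_acts_by Pw.
  exists f => _ w'; rewrite -eX => -[u Ku <-] q.
  by rewrite h -mulmxA (pointwise_stab_BQ hDelta hphi hg' Ku (set_valP q)).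
exists rho; split.
- by move=> X w q ZX Xw; exact: rhoP.
- move=> _ _ [w Pw <-] [w' Pw' <-]; rewrite left_coset_mulE //.
  have Zc v : P v -> Z (left_coset K v) by move=> Pv; exists v.
  have Pww := preimZM Pw Pw'.
  apply: acts_by_eq (rhoP _ (Zc _ Pww) _ (left_coset_refl _)) _.
  by apply: acts_by_comp; apply: rhoP; try exact: Zc; exact: left_coset_refl.
rewrite deck_orbit_map; split.
- move=> _ [w Pw <-]; exists w => //; apply: rhoP; first by exists w.
  exact: left_coset_refl.
- move=> X X' /set_mem ZX /set_mem ZX' e.
  have [[w Pw eX] [w' Pw' eX']] := (ZX, ZX').
  rewrite -eX -eX'; apply: left_coset_eq => //.
  have Xw : X w by rewrite -eX; exact: left_coset_refl.
  have Xw' : X' w' by rewrite -eX'; exact: left_coset_refl.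
  by have := rhoP X ZX w Xw x0; rewrite e (rhoP X' ZX' w' Xw' x0) => ->.
- move=> f [w Pw h]; have ZX : Z (left_coset K w) by exists w.
  exists (left_coset K w) => //.
  exact: acts_by_eq (rhoP _ ZX _ (left_coset_refl w)) h.
Qed.

(** * Orbits of Z and irregular classes *)

Lemma irr_class_ofP (q q' : irr_type) :
  cl q = cl q' <-> exists2 w, weyl D w & q' = w *m q.
Proof. by split=> [/eqquotP/asboolP|h]; last exact/eqquotP/asboolP. Qed.

Lemma BTheta_irr_class_of q : B q -> BTheta phi r Th (cl q).
Proof.
move=> Bq; have [[g2 [gQ gq]] _] := Bq; split.
- by exists Q; split=> //; exists g2.
- by exists q; split=> //; exists g2.
- by exists Q, q.
Qed.

Lemma BTheta_rep th : BTheta phi r Th th -> exists q, B q /\ cl q = th.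
Proof.
move=> [_ _ [Q1 [Q2 [/esym/irr_class_ofP[w Ww e1] <- adm]]]].
exists (invmx w *m Q2); split; first exact: (BQ_conj hphi Ww e1 adm).
apply/irr_class_ofP; exists w => //.
by rewrite mulKVmx // (weyl_unit Ww).
Qed.

Lemma irr_class_of_fibre q q' : B q -> B q' -> cl q = cl q' ->
  exists2 w, P w & q' = w *m q.
Proof.
move=> Bq Bq' /irr_class_ofP[w Ww e]; exists w => //.
by apply: (BQ_preimZ hDelta hphi hg' Ww Bq); rewrite -e.
Qed.

Lemma closed_saturation (F : set irr_type) : closed F ->
  closed [set th | exists2 q, F q & cl q = th].
Proof.
move=> cF.
have quotient_closed (S : set (irr_class R D s)) :
    closed (cl @^-1` S) -> closed S.
  by move=> cS; rewrite -openC; exact: (closed_openC cS).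
apply: quotient_closed.
have -> : cl @^-1` [set th | exists2 q, F q & cl q = th] =
    \bigcup_(w in @weyl R n D) (mulmx w @^-1` F).
  apply/seteqP; split=> [q [q1 Fq1 /esym/irr_class_ofP[w Ww e]]|q [w Ww Fwq]].
    by exists w => //=; rewrite -e.
  exists (w *m q) => //; apply/esym/irr_class_ofP; by exists w.
apply: closed_bigcup; first exact: finite_weyl.
move=> w _; apply: preimage_closed => // q _; exact: mulmx_continuous.
Qed.

Lemma exists_class_homeomorphism : exists h : Y -> BTheta phi r Th,
  homeomorphism h /\ forall q : B, set_val (h (p q)) = cl (set_val q).
Proof.
pose h (y : Y) : BTheta phi r Th :=
  SigSub (mem_set (BTheta_irr_class_of (set_valP (repr y : B)))).
have hp q : set_val (h (p q)) = cl (set_val q).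
  have /orbit_mapP[f [w [Ww _] fw] fq] : p (repr (p q)) = p q by exact: reprK.
  apply/irr_class_ofP; exists w => //.
  exact: etrans (congr1 set_val (esym fq)) (fw _).
have /choice[k kP] (th : BTheta phi r Th) : exists y, exists2 q, p q = y &
    cl (set_val q) = set_val th.
  have [q [Bq e]] := BTheta_rep (set_valP th).
  pose q1 : B := SigSub (mem_set Bq).
  by exists (p q1); exists q1.
have kh : cancel h k.
  move=> y; have [q pq e] := kP (h y); have [q1 pq1] := orbit_map_surj y.
  rewrite -pq -pq1; apply/orbit_mapP.
  have := e; rewrite -pq1 hp.
  move=> /(irr_class_of_fibre (set_valP q) (set_valP q1))[w Pw e1].
  have [f fw] := exists_acts_by Pw; exists f; first by exists w.
  by apply/val_inj; exact: etrans (fw q) (esym e1).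
have hk : cancel k h.
  move=> th; apply/val_inj; have [q <- e] := kP th; exact: etrans (hp q) e.
exists h; split=> //; split.
  apply/quotient_continuous.
  apply: (@continuous_comp_initial _ B _ set_val).
  rewrite (_ : _ \o _ = cl \o set_val); last exact/funext.
  move=> q; apply: continuous_comp; first exact: initial_continuous.
  exact: pi_continuous.
exists k; split=> //.
apply/continuous_closedP => F cF.
have [F0 oF0 F0E] : open (p @^-1` (~` F)).
  exact: (closed_openC cF).
(* A closed subset of t^s that represents [F]. Cutting with the closed stratum ensures that a Weyl
   translate of a point of B(Q) lying in [F1] is again in B(Q), hence in the same orbit of Z. *)
pose F1 := ~` F0 `&` closed_stratum D phi r Q g'.
have cF1 : closed F1.
  by apply: closedI; [exact: open_closedC|exact: closed_stratum_closed].
have F0P (q : B) : F (p q) <-> (~` F0) (set_val q).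
  have e : F0 (set_val q) = (~` F) (p q) :> Prop.
    exact (congr1 (fun A : set B => A q) F0E).
  by rewrite /setC /= e; split=> [Fq nFq //|]; exact: contrapT.
have -> : k @^-1` F = set_val @^-1` [set th | exists2 q, F1 q & cl q = th].
  apply/seteqP; split=> [th /= Fk|th /= [q1 [nq1 sq1] e1]].
    have [q pq e] := kP th; exists (set_val q) => //; split.
      by apply/F0P; rewrite pq.
    exact: (BQ_closed_stratum hDelta hphi hg' (set_valP q)).
  have [q <- e] := kP th.
  have /irr_class_ofP[w Ww e2] : cl (set_val q) = cl q1 by rewrite e -e1.
  have Bq1 : B q1.
    rewrite e2; apply: (closed_stratum_weyl_BQ hDelta hphi hg' Ww (set_valP q)).
    by rewrite -e2.
  have Pw : P w.
    apply: (BQ_preimZ hDelta hphi hg' Ww (set_valP q)).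
    by rewrite -[w *m _]e2.
  have [f fw] := exists_acts_by Pw.
  have -> : p q = p (f q) by apply/orbit_mapP; exists f => //; exists w.
  by apply/F0P; rewrite fw -[w *m _]e2.
apply: preimage_closed; last exact: closed_saturation.
by move=> th _; exact: initial_continuous.
Qed.

End Quotient.

Theorem mainTheorem6 (R : realType) (n : nat) (D : rootDatum n)
    (Delta : {set D}) (phi : 'M[Cx R]_n) (r s : nat)
    (Q : 'M[Cx R]_(n, s)) (g' : 'M[Cx R]_n)
    (hr : (0 < r)%N) (hs : (0 < s)%N)
    (hDelta : is_base Delta) (hphi : outer_aut Delta phi)
    (hg' : generates D phi r g' Q) :
  let g := phi *m g' in
  let P := preimZ D Q g in
  let K := pointwise_stab (levi_roots D Q 1) in
  let Z := Zgroup D Q g in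
  let B := BQ D phi r Q in
  let p : B -> orbit_space D phi r Q g' := orbit_map g' in
  [/\ normal_subgroup K P,
      galois_covering p,
      (exists rho : set 'M[Cx R]_n -> B -> B,
        [/\ (forall X w q, Z X -> X w -> set_val (rho X q) = w *m set_val q),
            (forall X Y, Z X -> Z Y -> rho (left_coset_mul X Y) = rho X \o rho Y)
          & set_bij Z (deck p) rho])
    & exists h : orbit_space D phi r Q g' -> BTheta phi r (irr_class_of D Q),
        homeomorphism h /\
        forall q : B, set_val (h (p q)) = irr_class_of D (set_val q)].
Proof.
split.
- exact: normal_pointwise_stab hDelta hphi hg' hs.
- exact: galois_covering_orbit_map hDelta hphi hg'.
- exact: exists_deck_action hDelta hphi hg' hs.
- exact: exists_class_homeomorphism hDelta hphi hg'.
Qed.
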